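(* Let $(z_j^\circ)_{j\ge1}$ be iid random variables with values in $\mathbb D$. For all $N\ge1$, all bounded random variables $Y_N=Y_N((z_j^\circ)_{j=1}^N)$ depending only on the $N$ first data, and all $m\ge1$, $$\kappa^\circ_{m+1}[Y_N]\,\lesssim_m\,\sum_{k=0}^{m-1}N^{k+1}\sum_{\substack{a_1,\dots,a_{m+1}\ge1\\ \sum_ja_j=m+k+1}}\ \prod_{j=1}^{m+1}\big\|(D^\circ)^{a_j}Y_N\big\|_{\ell^\infty_{\ne}\big(L^{\frac1{a_j}(m+k+1)}(\Omega^\circ)\big)}.$$
   Context: $\mathbb D=\mathbb T^d\times\mathbb R^d$. The iid data $(z_j^\circ)_{j\in\mathbb N}$ are defined on a probability space $(\Omega^\circ,\mathbb P^\circ)$ endowed with the $\sigma$-algebra they generate, with expectation $\mathbb E^\circ$. The Glauber derivative with respect to $z_k^\circ$ of $Y=Y((z_j^\circ)_j)$ is $D_k^\circ Y=Y-\mathbb E_k^\circ[Y]$, where $\mathbb E_k^\circ$ denotes integration with respect to the variable $z_k^\circ$ only. For iterated derivatives, $$\|(D^\circ)^nY\|_{\ell^\infty_{\ne}(L^p(\Omega^\circ))}=\sup_{j_1,\dots,j_n\ \text{distinct}}\|D^\circ_{j_1}\cdots D^\circ_{j_n}Y\|_{L^p(\Omega^\circ)}.$$ The $m$-th cumulant of a bounded random variable is $\kappa_m^\circ[Y]=\big((\frac{d}{dt})^m\log\mathbb E^\circ[e^{tY}]\big)|_{t=0}=\sum_{\pi\vdash[m]}(-1)^{|\pi|-1}(|\pi|-1)!\prod_{B\in\pi}\mathbb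 E^\circ[Y^{|B|}]$ (sum over partitions $\pi$ of $\{1,\dots,m\}$, product over blocks $B$). The notation $\lesssim_m$ means $\le C\times$ with a constant $C$ depending only on $d$ and $m$. *)

(* Defs.v *)
From HB Require Import structures.
From mathcomp Require Import all_boot all_order all_algebra generic_quotient.
From mathcomp Require Import all_classical all_reals all_analysis.

Set Implicit Arguments.
Unset Strict Implicit.
Unset Printing Implicit Defensive.

Import Order.TTheory GRing.Theory Num.Theory.
Import numFieldNormedType.Exports.

Local Open Scope classical_set_scope.
Local Open Scope ring_scope.
Local Open Scope quotient_scope.

(* The one-dimensional torus is R / Z (the quotient by congr_int) with its     *)
(* quotient topology and the resulting Borel sigma-algebra.                   *)
Section torus.
Variable R : realType.

Definition congr_int (x y : R) : bool := (x - y) \is a Num.int.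

Lemma congr_int_equiv : equiv_class_of congr_int.
Proof.
split=> [x|x y|y x z]; rewrite /congr_int.
- by rewrite subrr rpred0.
- by rewrite -rpredN opprB.
- move=> xy yz.
  by have := rpredD xy yz; rewrite addrA subrK.
Qed.

Canonical congr_int_equiv_rel := EquivRelPack congr_int_equiv.

Definition torus_quot : Type := {eq_quot congr_int}.
HB.instance Definition _ := Quotient.on torus_quot.

Definition torus_top : Type := quotient_topology torus_quot.
HB.instance Definition _ := Topological.on torus_top.
HB.instance Definition _ := Pointed.on torus_top.

Definition torus : Type := g_sigma_algebraType (@open torus_top).
HB.instance Definition _ := Measurable.on torus.

End torus.

Definition phase_space (R : realType) (d : nat) : Type :=
  (d.-tuple (torus R) * d.-tuple (measurableTypeR R))%type.
HB.instance Definition _ (R : realType) (d : nat) :=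
  Measurable.on (phase_space R d).

Section glauber.
Context (R : realType) (dO : measure_display) (Omega : measurableType dO).
Context (P : probability Omega R).
Context (dT : measure_display) (T : measurableType dT).

Definition identically_distributed (z : nat -> {RV P >-> T}) : Prop :=
  forall (j : nat) (A : set T), measurable A ->
    P (z j @^-1` A) = P (z 0%N @^-1` A).

Definition mutually_independent (z : nat -> {RV P >-> T}) : Prop :=
  forall (s : seq nat) (A : nat -> set T), uniq s ->
    (forall j, measurable (A j)) ->
    P (\bigcap_(j in [set` s]) z j @^-1` A j)
    = (\prod_(j <- s) P (z j @^-1` A j))%E.

Definition generate_sigma_algebra (z : nat -> {RV P >-> T}) : Prop :=
  (measurable : set (set Omega))
  = <<s \bigcup_j preimage_set_system setT (z j) measurable >>.

(* Random variables Y = Y((z_j)_j) are represented by functionals of the      *)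
(* sequence of data, so that integrating out the variable z_k alone makes     *)
(* sense pointwise; the random variable itself is eval_data z Y.              *)
Definition functional := (nat -> T) -> R.

Definition eval_data (z : nat -> {RV P >-> T}) (Y : functional) : Omega -> R :=
  fun w => Y (fun j => z j w).

Definition of_first (N : nat) (f : N.-tuple T -> R) : functional :=
  fun x => f [tuple x i | i < N].

Definition partial_expectation (z : nat -> {RV P >-> T}) (k : nat)
    (Y : functional) : functional :=
  fun x => fine ('E_P[fun w => Y [eta x with k |-> z k w]])%E.

Definition glauber (z : nat -> {RV P >-> T}) (k : nat) (Y : functional) :
    functional :=
  fun x => Y x - partial_expectation z k Y x.

Definition iter_glauber (z : nat -> {RV P >-> T}) (s : seq nat)
    (Y : functional) : functional :=
  foldr (glauber z) Y s.

Definition glauber_norm (z : nat -> {RV P >-> T}) (n : nat) (p : R)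
    (Y : functional) : \bar R :=
  ereal_sup [set Lnorm P p%:E (EFin \o eval_data z (iter_glauber z s Y))
            | s in [set s : seq nat | size s = n /\ uniq s]].

Definition cumulant (m : nat) (X : Omega -> R) : R :=
  derive1n m (fun t : R => ln (fine ('M_P X t))) 0.

End glauber.

(* Main.v *)
(** The joint cumulants kappa_n(X) = kappa(X, Y, ..., Y), with n copies of Y,
    obey a recursion: write X - E X as the sum over k of its martingale
    increments M_k X, replace z_k by an independent copy in M_k X Y^n, and
    expand Y'^n = (Y + (Y' - Y))^n.  This gives
      kappa_n(X) = sum_k sum_(b >= 1) 'C(n, b) kappa_(n-b)(T_(k,b) X),
      T_(k,b) X = E'_k[(M_k X)' (Y' - Y)^b],
    and E' averages only z_k.  Starting from X = Y, every functional produced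
    by the recursion is estimated like a product of Glauber derivatives of Y:
    T_(k,b) adds b factors, and if the coordinate k has not been used before it
    also adds one more derivative to X, which pays for the factor N coming from
    the sum over k; the coordinates used before are boundedly many.  In the end
    kappa_m(Y) is bounded by products of m + 1 derivatives of total order
    Q = m + k + 1, and Hoelder's inequality with exponents Q / a_j applies. *)

Require Import Defs.
From HB Require Import structures.
From mathcomp Require Import all_boot all_order all_algebra.
From mathcomp Require Import all_classical all_reals all_analysis.
From mathcomp Require Import measurable_realfun.
From mathcomp Require Import ring lra zify.

Set Implicit Arguments.
Unset Strict Implicit.
Unset Printing Implicit Defensive.

Import Order.TTheory GRing.Theory Num.Theory.
Import numFieldNormedType.Exports.

Local Open Scope classical_set_scope.
Local Open Scope ring_scope.

(** The norms in the theorem run over distinct coordinates, so differentiating again in a used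
    coordinate gains nothing and merely costs a factor 2. Every bound therefore carries the list of
    used coordinates. How many fresh coordinates the recursion meets, hence the total order Q, is
    known only at its end. The bounds are thus proved for all large enough Q at once. The functional
    Y itself has order 0 and fits no such bound. The first step of the recursion starts instead from
    D_k Y, of order 1, and its sum over k is not compensated by any gain: this is why the power of N
    exceeds by one the number of additional derivatives. Glauber derivatives obey no exact Leibniz
    rule. In the variant used here each derivative falls on one factor, one of the two terms keeping
    an outer D_k, and a product pays 3 = 2 + 1 per derivative. The numbers kappa_n(X) are defined by
    the recursion alone. They agree with the cumulants because, for X = Y, both solve the same
    triangular moment-cumulant system, which has only one solution. *)

HB.lock Definition Lp d (O : measurableType d) (R : realType)
    (P : probability O R) (p : R) (f : O -> R) : R :=
  (\int[P]_w (`|f w| `^ p)) `^ p^-1.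

(** * Real-valued L^p norms of bounded functions: Minkowski, Hoelder, Jensen *)

Section bounded_functions.
Context d (O : measurableType d) (R : realType) (P : probability O R).
Implicit Types f g : O -> R.

Local Notation Lp := (Lp P).

Lemma LpE p f : Lp p f = (\int[P]_w (`|f w| `^ p)) `^ p^-1.
Proof. by rewrite Lp.unlock. Qed.

Definition bounded_measurable f :=
  measurable_fun [set: O] f /\ exists M : R, forall w, `|f w| <= M.

Lemma bounded_measurable_integrable f :
  bounded_measurable f -> P.-integrable [set: O] (EFin \o f).
Proof.
move=> [mf [M fM]]; apply: measurable_bounded_integrable => //.
  exact: (le_lt_trans (probability_le1 P measurableT) (ltry _)).
exists M; split; rewrite ?num_real // => M' MM' w _.
exact: le_trans (fM w) (ltW MM').
Qed.

Lemma bounded_measurableD f g :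
  bounded_measurable f -> bounded_measurable g -> bounded_measurable (f + g).
Proof.
move=> [mf [M fM]] [mg [M' gM]]; split; first exact: measurable_funD.
by exists (M + M') => w; rewrite (le_trans (ler_normD _ _)) ?lerD.
Qed.

Lemma bounded_measurableM f g :
  bounded_measurable f -> bounded_measurable g -> bounded_measurable (f * g).
Proof.
move=> [mf [M fM]] [mg [M' gM]]; split; first exact: measurable_funM.
by exists (M * M') => w; rewrite normrM ler_pM.
Qed.

Lemma bounded_measurable_cst (c : R) : bounded_measurable (cst c).
Proof. by split; [exact: measurable_cst|exists `|c|]. Qed.

Lemma bounded_measurable_norm f :
  bounded_measurable f -> bounded_measurable (fun w => `|f w|).
Proof.
move=> [mf [M fM]]; split; first exact: measurableT_comp.
by exists M => w; rewrite normr_id.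
Qed.

Lemma bounded_measurable_powR f (p : R) : 0 <= p ->
  bounded_measurable f -> bounded_measurable (fun w => `|f w| `^ p).
Proof.
move=> p0 [mf [M fM]]; split.
  by apply: (@measurableT_comp _ _ _ _ _ _ (fun x : R => x `^ p));
    [exact: measurable_powR|exact: measurableT_comp].
exists (M `^ p) => w; rewrite ger0_norm ?powR_ge0// ge0_ler_powR ?nnegrE//.
exact: le_trans (fM w).
Qed.

Lemma bounded_measurableX f n :
  bounded_measurable f -> bounded_measurable (f ^+ n).
Proof.
move=> bf; elim: n => [|n IH]; first exact: bounded_measurable_cst.
by rewrite exprS; apply: bounded_measurableM.
Qed.

Lemma EFin_Rintegral f : bounded_measurable f ->
  (\int[P]_w f w)%:E = (\int[P]_w (f w)%:E)%E.
Proof. move=> bf; rewrite fineK//; apply: integrable_fin_num => //.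
exact: bounded_measurable_integrable. Qed.

Lemma Rintegral_prob_cst (c : R) : \int[P]_w c = c.
Proof. by rewrite Rintegral_cst// [X in fine X](probability_setT P) mulr1. Qed.

Lemma Rintegral_addf f g : bounded_measurable f -> bounded_measurable g ->
  \int[P]_w (f + g) w = \int[P]_w f w + \int[P]_w g w.
Proof. by move=> bf bg; rewrite RintegralD//; exact: bounded_measurable_integrable. Qed.

Lemma Rintegral_scalef (c : R) f : bounded_measurable f ->
  \int[P]_w (cst c * f) w = c * \int[P]_w f w.
Proof. by move=> bf; rewrite -RintegralZl//; exact: bounded_measurable_integrable. Qed.

Lemma ler_Rintegral f g : bounded_measurable f -> bounded_measurable g ->
  (forall w, f w <= g w) -> \int[P]_w f w <= \int[P]_w g w.
Proof. by move=> bf bg fg; apply: le_Rintegral => //; exact: bounded_measurable_integrable. Qed.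

Lemma Lp_ge0 p f : 0 <= Lp p f. Proof. by rewrite LpE; exact: powR_ge0. Qed.

Lemma Lnorm_Lp p f : 0 <= p -> bounded_measurable f ->
  Lnorm P p%:E (EFin \o f) = (Lp p f)%:E.
Proof.
move=> p0 bf; rewrite unlock LpE -poweR_EFin EFin_Rintegral//.
exact: bounded_measurable_powR.
Qed.

Lemma LpX p f : 0 < p -> (Lp p f) `^ p = \int[P]_w (`|f w| `^ p).
Proof.
move=> p0; rewrite !LpE -powRrM mulVf ?gt_eqF// powRr1//.
by apply: Rintegral_ge0 => w _; exact: powR_ge0.
Qed.

Lemma Lp1 f : Lp 1 f = \int[P]_w `|f w|.
Proof.
rewrite !LpE invr1 powRr1.
  by apply: eq_Rintegral => w _; rewrite powRr1.
by apply: Rintegral_ge0 => w _; exact: powR_ge0.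
Qed.

Lemma ler_LpD p f g : 1 <= p -> bounded_measurable f -> bounded_measurable g ->
  Lp p (f + g) <= Lp p f + Lp p g.
Proof.
move=> p1 bf bg; have p0 : 0 <= p := le_trans ler01 p1.
have [[mf _] [mg _]] := (bf, bg).
rewrite -lee_fin EFinD -(Lnorm_Lp p0 bf) -(Lnorm_Lp p0 bg).
rewrite -(Lnorm_Lp p0 (bounded_measurableD bf bg)).
exact: minkowski_EFin.
Qed.

Lemma hoelder1_Lp p q f g : 0 < p -> 0 < q -> p^-1 + q^-1 = 1 ->
  bounded_measurable f -> bounded_measurable g ->
  \int[P]_w `|f w * g w| <= Lp p f * Lp q g.
Proof.
move=> p0 q0 pq bf bg; have [[mf _] [mg _]] := (bf, bg).
rewrite -(Lp1 (f * g)) -lee_fin EFinM.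
rewrite -(Lnorm_Lp (ltW p0) bf) -(Lnorm_Lp (ltW q0) bg).
rewrite -(Lnorm_Lp ler01 (bounded_measurableM bf bg)).
exact: hoelder.
Qed.

Lemma Lp_powR p r f : 0 < p -> 0 < r ->
  Lp (p / r) (fun w => `|f w| `^ r) = (Lp p f) `^ r.
Proof.
move=> p0 r0; rewrite !LpE -powRrM invf_div [p^-1 * r]mulrC; congr (_ `^ _).
apply: eq_Rintegral => w _.
rewrite ger0_norm ?powR_ge0// -powRrM [r * _]mulrC. 
by rewrite divfK ?gt_eqF.
Qed.

(** Apply the conjugate case to |f|^r and |g|^r with the exponents p/r and q/r, then take r-th
    roots. *)
Lemma ler_LpM p q r f g : 0 < p -> 0 < q -> 0 < r -> r^-1 = p^-1 + q^-1 ->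
  bounded_measurable f -> bounded_measurable g ->
  Lp r (f * g) <= Lp p f * Lp q g.
Proof.
move=> p0 q0 r0 rpq bf bg.
have [r0' p0' q0'] : [/\ r != 0, p != 0 & q != 0] by rewrite !gt_eqF.
have : Lp r (f * g) `^ r <= (Lp p f * Lp q g) `^ r.
  rewrite LpX// powRM ?Lp_ge0// -2?Lp_powR//.
  have := @hoelder1_Lp (p / r) (q / r) (fun w => `|f w| `^ r)
    (fun w => `|g w| `^ r).
  rewrite !divr_gt0// !invf_div -mulrDr -rpq mulfV//.
  move=> /(_ isT isT erefl (bounded_measurable_powR (ltW r0) bf)
    (bounded_measurable_powR (ltW r0) bg)).
  apply: le_trans; rewrite le_eqVlt; apply/orP; left; apply/eqP.
  apply: eq_Rintegral => w _.
  by rewrite -powRM// [RHS]ger0_norm ?powR_ge0// -normrM.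
move=> /(ge0_ler_powR (r := r^-1)); rewrite !nnegrE !powR_ge0 invr_ge0 (ltW r0).
by rewrite -!powRrM mulfV// !powRr1 ?mulr_ge0 ?Lp_ge0//; apply.
Qed.

Lemma ler_norm_Rintegral_powR p f : 1 <= p -> bounded_measurable f ->
  `|\int[P]_w f w| `^ p <= \int[P]_w (`|f w| `^ p).
Proof.
move=> p1 bf; have p0 : 0 < p := lt_le_trans ltr01 p1.
rewrite -LpX//; apply: ge0_ler_powR; rewrite ?nnegrE ?Lp_ge0 ?(ltW p0)//.
apply: (@le_trans _ _ (\int[P]_w `|f w|)).
  by apply: le_normr_Rintegral => //; exact: bounded_measurable_integrable.
(* Jensen follows from Hoelder against the constant 1; for p = 1 the conjugate exponent would be
   infinite, so that case is split off. *)
move: p1; rewrite le_eqVlt => /predU1P[<-|p1]; first by rewrite Lp1.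
have q1 : 0 < 1 - p^-1 by rewrite subr_gt0 invf_lt1.
have := @hoelder1_Lp p (1 - p^-1)^-1 f (cst 1).
rewrite p0 invr_gt0 q1 invrK addrC subrK.
move=> /(_ isT isT erefl bf (bounded_measurable_cst _)).
rewrite [Lp _ (cst 1)]LpE (_ : (fun _ => `|cst 1 _| `^ _) = cst 1); last first.
  by apply/funext => w; rewrite normr1 powR1.
rewrite Rintegral_prob_cst powR1 mulr1; apply: le_trans.
rewrite le_eqVlt; apply/orP; left; apply/eqP.
by apply: eq_Rintegral => w _; rewrite mulr1.
Qed.

End bounded_functions.

(** * The class of functionals on which all operations act *)

Section admissible_functionals.
Context (R : realType) (dO : measure_display) (Omega : measurableType dO).
Context (P : probability Omega R).
Context (dT : measure_display) (T : measurableType dT).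
Context (z : nat -> {RV P >-> T}) (N : nat).
Implicit Types (X Y : functional R T) (k l : nat) (x y : nat -> T).

Local Notation E := (partial_expectation z).
Local Notation D := (glauber z).

(** The space of sequences carries no sigma-algebra here, so measurability is tested along every
    measurable family of sequences. The parameter space [S] will be the sample space, a product with
    it, or the space of [N]-tuples. *)
Definition admissible X :=
  [/\ exists M : R, forall x, `|X x| <= M,
      forall x y, (forall j, (j < N)%N -> x j = y j) -> X x = X y &
      forall d (S : measurableType d) (g : nat -> S -> T),
        (forall j, measurable_fun [set: S] (g j)) ->
        measurable_fun [set: S] (fun s => X (g ^~ s))].

Lemma admissible_cst (c : R) : admissible (cst c).
Proof. by split => //; exists `|c|. Qed.

Lemma admissibleD X Y : admissible X -> admissible Y -> admissible (X + Y).
Proof.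
move=> [[M XM] dX mX] [[M' YM] dY mY]; split.
- by exists (M + M') => x; rewrite (le_trans (ler_normD _ _)) ?lerD.
- by move=> x y xy; rewrite !fctE (dX _ y)// (dY _ y).
- by move=> d S g mg; apply: measurable_funD; [exact: mX|exact: mY].
Qed.

Lemma admissibleM X Y : admissible X -> admissible Y -> admissible (X * Y).
Proof.
move=> [[M XM] dX mX] [[M' YM] dY mY]; split.
- by exists (M * M') => x; rewrite normrM ler_pM.
- by move=> x y xy; rewrite !fctE (dX _ y)// (dY _ y).
- by move=> d S g mg; apply: measurable_funM; [exact: mX|exact: mY].
Qed.

Lemma admissible0 : admissible 0. Proof. exact: (admissible_cst 0). Qed.

Lemma admissible1 : admissible 1. Proof. exact: (admissible_cst 1). Qed.

Lemma admissibleN X : admissible X -> admissible (- X).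
Proof.
move=> aX; rewrite (_ : - X = cst (-1) * X).
  exact: admissibleM (admissible_cst _) aX.
by apply/funext => x; rewrite !fctE mulN1r.
Qed.

Lemma admissibleB X Y : admissible X -> admissible Y -> admissible (X - Y).
Proof. by move=> aX aY; apply: admissibleD => //; exact: admissibleN. Qed.

Lemma admissibleX X n : admissible X -> admissible (X ^+ n).
Proof.
move=> aX; elim: n => [|n IH]; first exact: admissible1.
by rewrite exprS; apply: admissibleM.
Qed.

Lemma admissibleMn X n : admissible X -> admissible (X *+ n).
Proof.
move=> aX; elim: n => [|n IH]; first exact: admissible0.
by rewrite mulrS; apply: admissibleD.
Qed.

Lemma admissible_sum (I : Type) (r : seq I) (Q : pred I) (F : I -> functional R T) :
  (forall i, Q i -> admissible (F i)) -> admissible (\sum_(i <- r | Q i) F i).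
Proof.
by move=> aF; elim/big_rec: _ => [|i X Qi aX];
  [exact: admissible0|apply: admissibleD; [exact: aF|]].
Qed.

Lemma admissible_abs_powR X (p : R) : 0 <= p ->
  admissible X -> admissible (fun x => `|X x| `^ p).
Proof.
move=> p0 [[M XM] dX mX]; split.
- exists (M `^ p) => x; rewrite ger0_norm ?powR_ge0// ge0_ler_powR ?nnegrE//.
  exact: le_trans (XM x).
- by move=> x y xy; rewrite (dX _ y).
- move=> d S g mg.
  apply: (@measurableT_comp _ _ _ _ _ _ (fun x : R => x `^ p)).
    exact: measurable_powR.
  by apply: measurableT_comp => //; exact: mX.
Qed.

Lemma admissible_eval X : admissible X -> bounded_measurable (eval_data z X).
Proof.
move=> [[M XM] _ mX]; split; last by exists M => w; exact: XM.
by apply: mX.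
Qed.

Lemma measurable_replace d (S : measurableType d) (g : nat -> S -> T)
    (h : S -> T) k :
  (forall j, measurable_fun [set: S] (g j)) -> measurable_fun [set: S] h ->
  forall j, measurable_fun [set: S] (fun s => [eta g ^~ s with k |-> h s] j).
Proof. by move=> mg mh j /=; case: eqP => _; [exact: mh|exact: mg]. Qed.

Lemma admissible_section X x k : admissible X ->
  bounded_measurable (fun w => X [eta x with k |-> z k w]).
Proof.
move=> [[M XM] _ mX]; split; last by exists M => w; exact: XM.
apply: (mX _ _ (fun j w => [eta x with k |-> z k w] j)).
exact: (@measurable_replace _ _ (fun j w => x j)).
Qed.

Lemma partial_expectationE k X x :
  E k X x = \int[P]_w X [eta x with k |-> z k w].
Proof. by rewrite /partial_expectation unlock. Qed.

Lemma admissible_partial_expectation k X : admissible X -> admissible (E k X).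
Proof.
move=> aX; have [[M XM] dX mX] := aX; split.
- exists M => x; rewrite partial_expectationE.
  have bX := admissible_section x k aX.
  apply: (le_trans (le_normr_Rintegral _ _)) => //.
    exact: bounded_measurable_integrable.
  rewrite -[leRHS](Rintegral_prob_cst P).
  by apply: ler_Rintegral => //; [exact: bounded_measurable_norm|exact: bounded_measurable_cst].
- move=> x y xy; rewrite !partial_expectationE; apply: eq_Rintegral => w _.
  by apply: dX => j jN /=; case: eqP => // _; exact: xy.
- move=> d S g mg.
  under eq_fun do rewrite partial_expectationE.
  (* Measurability of the parametrised integral comes from Tonelli, applied separately to the
     positive and negative parts of the jointly measurable [F]. *)
  pose F (u : S * Omega) := (X [eta g ^~ u.1 with k |-> z k u.2])%:E.
  have mF : measurable_fun [set: S * Omega] F.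
    apply/measurable_EFinP.
    apply: (mX _ _ (fun j (u : S * Omega) => [eta g ^~ u.1 with k |-> z k u.2] j)).
    apply: (@measurable_replace _ _ (fun j (u : S * Omega) => g j u.1)).
      by move=> j; exact: measurableT_comp.
    exact: measurableT_comp.
  have mpos := @measurable_fun_fubini_tonelli_F _ _ S Omega R P
    _ (measurable_funepos mF) (fun=> funepos_ge0 _ _).
  have mneg := @measurable_fun_fubini_tonelli_F _ _ S Omega R P
    _ (measurable_funeneg mF) (fun=> funeneg_ge0 _ _).
  apply: (@measurableT_comp _ _ _ _ _ _ fine) => //.
  rewrite (_ : (fun s => _) =
    (fubini_F P (F^\+)%E \- fubini_F P (F^\-)%E)%E).
    exact: emeasurable_funB.
  apply/funext => s; rewrite integralE /fubini_F.
  by congr (_ - _)%E; apply: eq_integral => w _; rewrite unlock.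
Qed.

Lemma admissible_glauber k X : admissible X -> admissible (D k X).
Proof. by move=> aX; apply: admissibleB => //; exact: admissible_partial_expectation. Qed.

Lemma admissible_iter s X : admissible X -> admissible (iter_glauber z s X).
Proof. by move=> aX; elim: s => //= k s IH; exact: admissible_glauber. Qed.

End admissible_functionals.

#[local] Hint Resolve admissible_cst admissibleD admissibleM admissible0
  admissible1 admissibleN admissibleB admissibleX admissibleMn admissible_partial_expectation
  admissible_glauber admissible_iter : core.

(** * Fubini for bounded functions *)

Section bounded_fubini.
Context d1 d2 (O1 : measurableType d1) (O2 : measurableType d2) (R : realType).
Context (P1 : probability O1 R) (P2 : probability O2 R).
Variable G : O1 * O2 -> R.
Hypothesis bG : bounded_measurable G.

Lemma bounded_measurable_pair1 x : bounded_measurable (fun y => G (x, y)).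
Proof.
have [mG [M GM]] := bG; split; last by exists M => y.
exact: measurableT_comp mG (pair1_measurable x).
Qed.

Lemma bounded_measurable_pair2 y : bounded_measurable (fun x => G (x, y)).
Proof.
have [mG [M GM]] := bG; split; last by exists M => x.
exact: measurableT_comp mG (pair2_measurable y).
Qed.

Lemma Rintegral_prod :
  \int[(P1 \x P2)%E]_u G u = \int[P1]_x \int[P2]_y G (x, y).
Proof.
have := integral12_prod_meas1 (bounded_measurable_integrable (P1 \x P2)%E bG).
rewrite /Rintegral => <-; congr fine; apply: eq_integral => x _.
by rewrite (EFin_Rintegral P2 (bounded_measurable_pair1 x)).
Qed.

Lemma Rintegral_exchange :
  \int[P1]_x \int[P2]_y G (x, y) = \int[P2]_y \int[P1]_x G (x, y).
Proof.
rewrite -Rintegral_prod.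
have := integral21_prod_meas1 (bounded_measurable_integrable (P1 \x P2)%E bG).
rewrite /Rintegral => <-; congr fine; apply: eq_integral => y _.
by rewrite (EFin_Rintegral P1 (bounded_measurable_pair2 y)).
Qed.

End bounded_fubini.

(** * Algebra of partial expectations and Glauber derivatives *)

Section glauber_calculus.
Context (R : realType) (dO : measure_display) (Omega : measurableType dO).
Context (P : probability Omega R).
Context (dT : measure_display) (T : measurableType dT).
Context (z : nat -> {RV P >-> T}) (N : nat).
Implicit Types (X Y : functional R T) (k l : nat) (x y : nat -> T).

Local Notation E := (partial_expectation z).
Local Notation D := (glauber z).
Local Notation adm := (@admissible R dT T N).

Lemma partial_expectationD k X Y : adm X -> adm Y -> E k (X + Y) = E k X + E k Y.
Proof.
move=> aX aY; apply/funext => x; rewrite !fctE !partial_expectationE.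
exact: Rintegral_addf (admissible_section z x k aX) (admissible_section z x k aY).
Qed.

Lemma partial_expectation_cst k (c : R) : E k (cst c) = cst c.
Proof.
by apply/funext => x; rewrite partial_expectationE/= Rintegral_prob_cst.
Qed.

Lemma replace_replace k x (a b : T) :
  [eta [eta x with k |-> a] with k |-> b] = [eta x with k |-> b] :> (nat -> T).
Proof. by apply/funext => j /=; case: eqP. Qed.

Lemma replaceC k l x (a b : T) : k != l ->
  [eta [eta x with k |-> a] with l |-> b] =
  [eta [eta x with l |-> b] with k |-> a] :> (nat -> T).
Proof.
move=> kl; apply/funext => j /=.
by have [->|//] := eqVneq j k; rewrite (negbTE kl).
Qed.

Lemma partial_expectation_replace k X x (a : T) :
  E k X [eta x with k |-> a] = E k X x.
Proof.
by rewrite !partial_expectationE; under eq_Rintegral do rewrite replace_replace.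
Qed.

Lemma partial_expectationM k X Y : adm X -> adm Y ->
  E k (X * E k Y) = E k X * E k Y.
Proof.
move=> aX aY; apply/funext => x; rewrite !fctE partial_expectationE.
transitivity (\int[P]_w (cst (E k Y x) *
    (fun w => X [eta x with k |-> z k w])) w).
  apply: eq_Rintegral => w _.
  by rewrite -[LHS]/(X _ * E k Y _) partial_expectation_replace mulrC.
rewrite (Rintegral_scalef P (E k Y x) (admissible_section z x k aX)).
by rewrite [E k X x]partial_expectationE mulrC.
Qed.

Lemma partial_expectation_id k X : adm X -> E k (E k X) = E k X.
Proof.
move=> aX; rewrite -[X in E k X]mul1r partial_expectationM//.
  by rewrite (partial_expectation_cst k 1) mul1r.
Qed.

(** For [k != l] this is Fubini on the square of the sample space, with two coordinates of a fixed
    sequence replaced by two independent draws. *)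
Lemma partial_expectationC k l X : adm X -> E k (E l X) = E l (E k X).
Proof.
have [->//|kl] := eqVneq k l.
move=> [[M XM] _ mX]; apply/funext => x; rewrite !partial_expectationE.
pose G (u : Omega * Omega) :=
  X [eta [eta x with k |-> z k u.1] with l |-> z l u.2].
have bG : bounded_measurable G.
  split; last by exists M => u; exact: XM.
  apply: (mX _ _ (fun j (u : Omega * Omega) =>
    [eta [eta x with k |-> z k u.1] with l |-> z l u.2] j)).
  apply: (@measurable_replace _ _ _ _ (fun j (u : Omega * Omega) =>
    [eta x with k |-> z k u.1] j)); last exact: measurableT_comp.
  apply: (@measurable_replace _ _ _ _ (fun j (u : Omega * Omega) => x j)) => //.
  exact: measurableT_comp.
have := Rintegral_exchange P P bG; rewrite /G /= => GE.
transitivity (\int[P]_w \int[P]_w' G (w, w')).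
  by apply: eq_Rintegral => w _; rewrite partial_expectationE.
rewrite GE; apply: eq_Rintegral => w _; rewrite partial_expectationE.
by apply: eq_Rintegral => w' _; rewrite replaceC.
Qed.

Lemma partial_expectation_out k X : adm X -> (N <= k)%N -> E k X = X.
Proof.
move=> [_ dX _] Nk; apply/funext => x; rewrite partial_expectationE.
rewrite -[RHS](Rintegral_prob_cst P); apply: eq_Rintegral => w _.
by apply: dX => j jN /=; case: eqP => // jk; move: jN; rewrite jk ltnNge Nk.
Qed.

Lemma partial_expectationN k X : adm X -> E k (- X) = - E k X.
Proof.
move=> aX; rewrite -[- X]mulN1r -[- E k X]mulN1r mulrC [RHS]mulrC.
rewrite (_ : -1 = E k (cst (-1))) ?partial_expectationM//.
by rewrite partial_expectation_cst.
Qed.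

Lemma partial_expectation0 k : E k 0 = 0.
Proof. exact: (partial_expectation_cst k 0). Qed.

Lemma partial_expectationB k X Y : adm X -> adm Y -> E k (X - Y) = E k X - E k Y.
Proof.
by move=> aX aY; rewrite partial_expectationD ?partial_expectationN//; auto.
Qed.

Lemma partial_expectation_sum k (I : Type) (r : seq I) (Q : pred I)
    (F : I -> functional R T) : (forall i, Q i -> adm (F i)) ->
  E k (\sum_(i <- r | Q i) F i) = \sum_(i <- r | Q i) E k (F i).
Proof.
move=> aF; elim: r => [|i r IH]; first by rewrite !big_nil partial_expectation0.
rewrite !big_cons; case: ifP => // Qi.
by rewrite partial_expectationD ?IH//; [exact: aF|exact: admissible_sum].
Qed.

Lemma glauberD k X Y : adm X -> adm Y -> D k (X + Y) = D k X + D k Y.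
Proof.
move=> aX aY; rewrite /glauber (_ : (fun x => _) = X + Y - E k (X + Y))//.
by rewrite partial_expectationD// opprD addrACA.
Qed.

Lemma glauberE k X : D k X = X - E k X. Proof. by []. Qed.

Lemma glauber0 k : D k 0 = 0.
Proof. by rewrite glauberE partial_expectation0 subrr. Qed.

Lemma partial_expectation_glauberC k l X : adm X -> E k (D l X) = D l (E k X).
Proof.
move=> aX; rewrite !glauberE partial_expectationB//; last auto.
by rewrite partial_expectationC.
Qed.

Lemma glauberC k l X : adm X -> D k (D l X) = D l (D k X).
Proof.
move=> aX; rewrite [LHS]glauberE partial_expectation_glauberC// glauberE.
rewrite (glauberE l (D k X)) partial_expectation_glauberC// !glauberE.
by rewrite (partial_expectationC k l)// opprB opprB addrACA [RHS]addrACA [- _ + _]addrC.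
Qed.

Lemma partial_expectation_glauber k X : adm X -> E k (D k X) = 0.
Proof.
move=> aX; rewrite glauberE partial_expectationB//; last auto.
by rewrite partial_expectation_id// subrr.
Qed.

Lemma glauberMr k X Y : adm X -> adm Y -> D k (E k X * Y) = E k X * D k Y.
Proof.
move=> aX aY; rewrite !glauberE mulrC partial_expectationM//.
by rewrite mulrBr mulrC [_ * E k X]mulrC.
Qed.

(* Replacing X by its fluctuation D_k X in the first term keeps a derivative   *)
(* with respect to z_k in each of the two terms.                              *)
Lemma glauberM k X Y : adm X -> adm Y ->
  D k (X * Y) = D k (D k X * Y) + E k X * D k Y.
Proof.
move=> aX aY; rewrite -glauberMr// -glauberD//; first 2 last; auto.
by rewrite -mulrDl glauberE subrK.
Qed.

Lemma partial_expectation_iterC k s X : adm X ->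
  E k (iter_glauber z s X) = iter_glauber z s (E k X).
Proof.
move=> aX; elim: s => //= l s <-; apply: partial_expectation_glauberC.
exact: admissible_iter.
Qed.

Lemma glauber_iterC k s X : adm X ->
  D k (iter_glauber z s X) = iter_glauber z s (D k X).
Proof.
by move=> aX; elim: s => //= l s <-; apply: glauberC; exact: admissible_iter.
Qed.

Lemma iter_glauberD s X Y : adm X -> adm Y ->
  iter_glauber z s (X + Y) = iter_glauber z s X + iter_glauber z s Y.
Proof.
by move=> aX aY; elim: s => //= l s ->; rewrite glauberD//; exact: admissible_iter.
Qed.

End glauber_calculus.

(** * Measures on tuples are determined by cylinders *)

Section cylinders.
Context d (T : measurableType d) (N : nat).

Definition cylinder (A : nat -> set T) : set (N.-tuple T) :=
  [set t | forall i : 'I_N, A i (tnth t i)].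

Lemma measurable_cylinder A : (forall j, measurable (A j)) ->
  measurable (cylinder A).
Proof.
move=> mA; rewrite (_ : cylinder A =
    \bigcap_(i in [set: 'I_N]) ((@tnth N T)^~ i @^-1` A i)); last first.
  by apply/seteqP; split => t At i; [move=> _; exact: At|exact: (At i)].
apply: fin_bigcap_measurable => // i _.
by rewrite -[X in measurable X]setTI; apply: measurable_tnth.
Qed.

Lemma measurable_tuple_cylinder :
  @measurable _ (N.-tuple T) =
  <<s [set B | exists2 A, (forall j, measurable (A j)) & B = cylinder A] >>.
Proof.
apply/seteqP; split; last first.
  apply: smallest_sub; first exact: sigma_algebra_measurable.
  by move=> _ [A mA ->]; exact: measurable_cylinder.
apply: smallest_sub; first exact: smallest_sigma_algebra.
move=> B; rewrite -bigcup_seq => -[i _ [A mA <-]].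
apply: sub_sigma_algebra.
exists (fun j => if j == i :> nat then A else setT) => [j|]; first by case: ifP.
rewrite setTI; apply/seteqP; split => t /=.
  by move=> At j; case: eqP => // /val_inj ->.
by move=> /(_ i); rewrite eqxx.
Qed.

Lemma cylinder_measure_unique (R : realType)
    (m1 m2 : {measure set (N.-tuple T) -> \bar R}) :
  (m1 setT < +oo)%E ->
  (forall A, (forall j, measurable (A j)) -> m1 (cylinder A) = m2 (cylinder A)) ->
  forall B, measurable B -> m1 B = m2 B.
Proof.
move=> m1oo m12.
have cT : cylinder (fun=> setT) = setT by apply/seteqP; split.
apply: (measure_unique
  [set B | exists2 A, (forall j, measurable (A j)) & B = cylinder A]
  (fun=> setT)) => //.
- exact: measurable_tuple_cylinder.
- move=> _ _ [A mA ->] [B mB ->]; exists (fun j => A j `&` B j).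
    by move=> j; exact: measurableI.
  apply/seteqP; split => t.
    by move=> [At Bt] i; split; [exact: At|exact: Bt].
  by move=> ABt; split => i; have [] := ABt i.
- by move=> _; exists (fun=> setT).
- by rewrite bigcup_const//; exists 0%N.
- by move=> _ [A mA ->]; exact: m12.
Qed.

End cylinders.

(** * Resampling one coordinate *)

Section independence.
Context (R : realType) (dO : measure_display) (Omega : measurableType dO).
Context (P : probability Omega R).
Context (dT : measure_display) (T : measurableType dT).
Context (z : nat -> {RV P >-> T}) (N : nat).
Implicit Types (X Y : functional R T) (k l : nat) (x y : nat -> T).

Local Notation E := (partial_expectation z).
Local Notation D := (glauber z).
Local Notation adm := (@admissible R dT T N).

Definition mean X : R := \int[P]_w eval_data z X w.

Hypothesis z_indep : mutually_independent z.

Let data (w : Omega) : N.-tuple T := [tuple z j w | j < N].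

Let resampled k (u : Omega * Omega) : N.-tuple T :=
  [tuple (if (j : nat) == k then z k u.2 else z j u.1) | j < N].

Let measurable_data : measurable_fun [set: Omega] data.
Proof.
apply/measurable_fun_tnthP => i.
by rewrite (_ : _ \o _ = z i)//; apply/funext => w /=; rewrite tnth_mktuple.
Qed.

Let measurable_resampled k : measurable_fun [set: Omega * Omega] (resampled k).
Proof.
apply/measurable_fun_tnthP => i.
rewrite (_ : _ \o _ = fun u => if (i : nat) == k then z k u.2 else z i u.1).
  by case: eqP => _; exact: measurableT_comp.
by apply/funext => u /=; rewrite tnth_mktuple.
Qed.

(** On a cylinder both laws factor over the coordinates, the factor of [k] coming from the second
    sample point. Every later use of independence passes through this lemma. *)
Lemma resampled_law k : (k < N)%N ->
  forall B, measurable B ->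
    pushforward (P \x P)%E (resampled k) B = pushforward P data B.
Proof.
move=> kN.
apply: (@cylinder_measure_unique _ _ _ _
  (pushforward (P \x P)%E (resampled k)) (pushforward P data)).
  exact: (le_lt_trans (probability_le1 (P \x P)%E measurableT) (ltry _)).
move=> A mA.
rewrite -[LHS]/((P \x P)%E (resampled k @^-1` cylinder A)).
rewrite -[RHS]/(P (data @^-1` cylinder A)).
have mzA j : measurable (z j @^-1` A j).
  by rewrite -[X in measurable X]setTI; exact: measurable_funP.
have -> : data @^-1` cylinder A =
    \bigcap_(j in [set` iota 0 N]) (z j @^-1` A j).
  apply/seteqP; split => w /=.
    move=> Aw j /=; rewrite mem_iota add0n => jN.
    by have := Aw (Ordinal jN); rewrite tnth_mktuple.
  by move=> Aw i; rewrite tnth_mktuple; apply: (Aw i); rewrite /= mem_iota add0n ltn_ord.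
have -> : resampled k @^-1` cylinder A =
    (\bigcap_(j in [set` rem k (iota 0 N)]) (z j @^-1` A j)) `*`
    (z k @^-1` A k).
  apply/seteqP; split => u /=.
    move=> Au; split => /=; last first.
      by have := Au (Ordinal kN); rewrite tnth_mktuple/= eqxx.
    move=> j /=; rewrite (rem_filter _ (iota_uniq _ _)) mem_filter mem_iota add0n.
    move=> /andP[/= jk jN].
    by have := Au (Ordinal jN); rewrite tnth_mktuple/= (negbTE jk).
  move=> [/= Au1 Au2] i; rewrite tnth_mktuple; have [->//|ik] := eqVneq (i : nat) k.
  apply: (Au1 i) => /=.
  by rewrite (rem_filter _ (iota_uniq _ _)) mem_filter mem_iota add0n /= ik/=.
rewrite product_measure1E//; last first.
  by apply: fin_bigcap_measurable => // j _; exact: mzA.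
rewrite !z_indep ?rem_uniq ?iota_uniq//.
rewrite [in RHS](big_rem k) ?mem_iota//= muleC; congr (_ * _)%E.
by apply: z_indep => //; rewrite rem_uniq ?iota_uniq.
Qed.

Lemma mean_partial_expectation k X : adm X -> mean (E k X) = mean X.
Proof.
move=> aX; have [Nk|kN] := leqP N k; first by rewrite (partial_expectation_out _ aX).
have [[M XM] dX mX] := aX.
(* [f] reads [X] off the first [N] data; the entries from [N] on take the default value [point],
   which [X] does not see. *)
pose f (t : N.-tuple T) := X (nth point t).
have mf : measurable_fun [set: N.-tuple T] f.
  apply: (mX _ _ (fun j (t : N.-tuple T) => nth point t j)) => j.
  have [jN|Nj] := ltnP j N; last first.
    rewrite (_ : (fun _ => _) = cst point)//.
    by apply/funext => t; rewrite nth_default// size_tuple.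
  rewrite (_ : (fun _ => _) = (@tnth N T)^~ (Ordinal jN)).
    exact: measurable_tnth.
  by apply/funext => t; rewrite (tnth_nth point).
have bf d (S : measurableType d) (phi : S -> N.-tuple T) :
    measurable_fun setT phi -> bounded_measurable (f \o phi).
  by move=> mphi; split; [exact: measurableT_comp|exists M => w; exact: XM].
have dataE w : eval_data z X w = f (data w).
  apply: dX => j jN; rewrite -(tnth_nth point (data w) (Ordinal jN)).
  by rewrite tnth_mktuple.
have resampledE u :
    X [eta (fun j => z j u.1) with k |-> z k u.2] = f (resampled k u).
  apply: dX => j jN; rewrite -(tnth_nth point (resampled k u) (Ordinal jN)).
  by rewrite tnth_mktuple.
rewrite /mean; under [RHS]eq_Rintegral do rewrite dataE.
transitivity (\int[P]_w \int[P]_w' f (resampled k (w, w'))).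
  apply: eq_Rintegral => w _; rewrite /eval_data partial_expectationE.
  by apply: eq_Rintegral => w' _; rewrite -resampledE.
rewrite -(@Rintegral_prod _ _ _ _ _ P P (fun u => f (resampled k u)))//; last first.
  exact: bf.
have mEf : measurable_fun [set: N.-tuple T] (EFin \o f) by exact/measurable_EFinP.
have pf d (S : measurableType d) (Q : probability S R) (phi : S -> N.-tuple T) :
    measurable_fun setT phi ->
    (\int[Q]_u (f (phi u))%:E = \int[pushforward Q phi]_t (f t)%:E)%E.
  move=> mphi; rewrite (@integral_pushforward _ _ _ _ _ phi mphi Q setT (EFin \o f))//.
  by rewrite preimage_setT; apply: bounded_measurable_integrable; exact: bf.
rewrite /Rintegral !pf//; congr fine; apply: eq_measure_integral => B mB _.
exact: resampled_law.
Qed.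

End independence.

(** Both sides become n! after multiplication by p! q! (n - p - q)!. *)
Lemma bin_mul_bin n p q : (p + q <= n)%N ->
  ('C(n, p) * 'C(n - p, q) = 'C(n, p + q) * 'C(p + q, p))%N.
Proof.
move=> pqn.
have f0 : (0 < p`! * (q`! * (n - (p + q))`!))%N by rewrite !muln_gt0 !fact_gt0.
apply/eqP; rewrite -(eqn_pmul2r f0); apply/eqP; transitivity n`!.
  rewrite mulnACA subnDA bin_fact; last lia.
  by rewrite -mulnA bin_fact//; lia.
rewrite -(bin_fact pqn) -(bin_fact (leq_addr q p)) addKn; ring.
Qed.

(** Regrouping by i = b + j; it collects the terms of one joint cumulant in
    [moment_joint_cumulant]. *)
Lemma sum_triangle (V : nmodType) (n : nat) (F : nat -> nat -> V) :
  \sum_(b < n) \sum_(j < n - b) F b j = \sum_(i < n) \sum_(b < i.+1) F b (i - b)%N.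
Proof.
elim: n => [|n IH]; first by rewrite !big_ord0.
rewrite [RHS]big_ord_recr/= -IH [LHS]big_ord_recr/= subSnn big_ord1.
rewrite [X in _ = _ + X]big_ord_recr/= subnn addrA; congr (_ + _).
rewrite -big_split; apply: eq_bigr => b _ /=.
by rewrite subSn ?big_ord_recr//= ltnW.
Qed.

(** * Martingale increments and the recursion for joint cumulants *)

Section joint_cumulant.
Context (R : realType) (dO : measure_display) (Omega : measurableType dO).
Context (P : probability Omega R).
Context (dT : measure_display) (T : measurableType dT).
Context (z : nat -> {RV P >-> T}) (N : nat).
Hypothesis z_indep : mutually_independent z.
Implicit Types (X : functional R T) (k l : nat) (x y : nat -> T).

Local Notation E := (partial_expectation z).
Local Notation D := (glauber z).
Local Notation adm := (@admissible R dT T N).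
Local Notation mean := (mean z).

Lemma meanD X X' : adm X -> adm X' -> mean (X + X') = mean X + mean X'.
Proof.
by move=> aX aX'; rewrite /mean -Rintegral_addf//; exact: (@admissible_eval _ _ _ _ _ _ _ N).
Qed.

Lemma mean_cst (c : R) : mean (cst c) = c.
Proof. exact: Rintegral_prob_cst. Qed.

Lemma meanZ (c : R) X : adm X -> mean (cst c * X) = c * mean X.
Proof.
by move=> aX; rewrite /mean -Rintegral_scalef//; exact: (@admissible_eval _ _ _ _ _ _ _ N).
Qed.

Lemma mean_sum (I : Type) (r : seq I) (Q : pred I) (F : I -> functional R T) :
  (forall i, Q i -> adm (F i)) ->
  mean (\sum_(i <- r | Q i) F i) = \sum_(i <- r | Q i) mean (F i).
Proof.
move=> aF; elim: r => [|i r IH]; first by rewrite !big_nil (mean_cst 0).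
rewrite !big_cons; case: ifP => // Qi.
by rewrite meanD ?IH//; [exact: aF|exact: admissible_sum].
Qed.

(** For independent data this is the conditional expectation given the first [k] data. *)
Definition tail_expectation k X := foldr E X (iota k (N - k)).

Lemma admissible_tail k X : adm X -> adm (tail_expectation k X).
Proof.
by move=> aX; rewrite /tail_expectation; elim: (iota _ _) => //= l s;
  exact: admissible_partial_expectation.
Qed.

Lemma tail_expectation_partial k l X : adm X ->
  tail_expectation k (E l X) = E l (tail_expectation k X).
Proof.
move=> aX; rewrite /tail_expectation; elim: (iota _ _) => //= j s ->.
apply: (@partial_expectationC _ _ _ _ _ _ _ N).
by elim: s => //= i s; exact: admissible_partial_expectation.
Qed.

Lemma tail_expectation_glauber k l X : adm X ->
  tail_expectation k (D l X) = D l (tail_expectation k X).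
Proof.
move=> aX; rewrite /tail_expectation; elim: (iota _ _) => //= j s ->.
apply: (@partial_expectation_glauberC _ _ _ _ _ _ _ N).
by elim: s => //= i s; exact: admissible_partial_expectation.
Qed.

Lemma tail_expectationS k X : (k < N)%N ->
  tail_expectation k X = E k (tail_expectation k.+1 X).
Proof. by move=> kN; rewrite /tail_expectation subnS -{1}[(N - k)%N]prednK ?subn_gt0. Qed.

Lemma partial_expectation_fixed_replace k X x (a : T) :
  E k X = X -> X [eta x with k |-> a] = X x.
Proof. by move=> <-; exact: partial_expectation_replace. Qed.

Lemma fixed_constant X x y : adm X -> (forall k, (k < N)%N -> E k X = X) ->
  X x = X y.
Proof.
move=> [_ dX _] EX.
(* Turn [x] into [y] one coordinate at a time. *)
suff H m : (m <= N)%N -> X (fun j => if (j < m)%N then y j else x j) = X x.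
  by rewrite -(H N)//; apply: dX => j ->.
elim: m => [_//|m IH mN]; rewrite -IH ?(ltnW mN)//.
rewrite -[RHS](partial_expectation_fixed_replace _ (y m) (EX m mN)).
congr (X _); apply/funext => j /=; rewrite ltnS leq_eqVlt.
by have [->|] := eqVneq j m.
Qed.

(** Every [E k] with [k < N] fixes the left side, since it commutes into the fold and is absorbed
    there. The left side is thus constant, and its value is the mean because averaging a coordinate
    preserves means. *)
Lemma tail_expectation0 X : adm X -> tail_expectation 0 X = cst (mean X).
Proof.
move=> aX; have at0 := admissible_tail 0 aX.
have cst0 x y : tail_expectation 0 X x = tail_expectation 0 X y.
  apply: fixed_constant => // k kN; rewrite -tail_expectation_partial//.
  rewrite /tail_expectation subn0; move: (iota_uniq 0 N).
  have : k \in iota 0 N by rewrite mem_iota.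
  elim: (iota _ _) => //= j s IH; rewrite inE => /orP[/eqP<- _|ks /andP[_ us]].
    have -> : foldr E (E k X) s = E k (foldr E X s).
      elim: s {IH} => //= i s ->.
      apply: (@partial_expectationC _ _ _ _ _ _ _ N).
      by elim: s => //= i' s; exact: admissible_partial_expectation.
    apply: (@partial_expectation_id _ _ _ _ _ _ _ N).
    by elim: s {IH} => //= i' s; exact: admissible_partial_expectation.
  by rewrite IH.
have mE : mean (tail_expectation 0 X) = mean X.
  rewrite /tail_expectation; elim: (iota _ _) => //= j s <-.
  apply: (@mean_partial_expectation _ _ _ _ _ _ _ N) => //.
  by elim: s => //= i' s; exact: admissible_partial_expectation.
apply/funext => x /=; rewrite -mE -[LHS](mean_cst (tail_expectation 0 X x)).
by apply: eq_Rintegral => w _; exact: cst0.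
Qed.

(** This equals [tail_expectation k.+1 X - tail_expectation k X]; with the Glauber derivative
    inside, bounds on [D k X] pass to it directly. *)
Definition martingale_increment k X := tail_expectation k.+1 (D k X).

Local Notation M := martingale_increment.

Lemma admissible_increment k X : adm X -> adm (M k X).
Proof. by move=> aX; apply: admissible_tail; exact: admissible_glauber. Qed.

Lemma martingale_decomposition X : adm X ->
  X = cst (mean X) + \sum_(k < N) M k X.
Proof.
move=> aX; rewrite -tail_expectation0//.
have -> : \sum_(k < N) M k X =
    \sum_(0 <= k < N) (tail_expectation k.+1 X - tail_expectation k X).
  rewrite big_mkord; apply: eq_bigr => k _.
  rewrite /martingale_increment tail_expectation_glauber// glauberE.
  by rewrite -tail_expectationS.
by rewrite telescope_sumr// addrC subrK /tail_expectation subnn.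
Qed.

Lemma partial_expectation_increment k X : adm X -> E k (M k X) = 0.
Proof.
move=> aX; rewrite /martingale_increment tail_expectation_glauber//.
by rewrite (@partial_expectation_glauber _ _ _ _ _ _ _ N)//; exact: admissible_tail.
Qed.

Variable Y : functional R T.
Hypothesis aY : adm Y.

(* With an independent copy x' of the coordinate k, this is                   *)
(* E'_k[(M_k X)(x') (Y(x') - Y(x))^b], see [transferE].                       *)
Definition transfer k b X : functional R T :=
  \sum_(i < b.+1)
    (- D k Y) ^+ i * E k (M k X * D k Y ^+ (b - i)) *+ 'C(b, i).

Lemma admissible_transfer k b X : adm X -> adm (transfer k b X).
Proof.
move=> aX; apply: admissible_sum => i _; apply: admissibleMn.
apply: admissibleM; first by apply/admissibleX/admissibleN/admissible_glauber.
apply/admissible_partial_expectation/admissibleM; first exact: admissible_increment.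
exact/admissibleX/admissible_glauber.
Qed.

Lemma partial_expectation_cstM k (c : R) X : adm X ->
  E k (X * cst c) = E k X * cst c.
Proof.
move=> aX; rewrite -{1}(partial_expectation_cst z k c).
by rewrite (@partial_expectationM _ _ _ _ _ _ _ N)// partial_expectation_cst.
Qed.

Lemma partial_expectationMn k X n : adm X -> E k (X *+ n) = E k X *+ n.
Proof.
move=> aX; elim: n => [|n IH].
  by rewrite !mulr0n (@partial_expectation0 _ _ _ P).
rewrite !mulrS (@partial_expectationD _ _ _ _ _ _ _ N) ?IH//.
exact: admissibleMn.
Qed.

Lemma partial_expectation_binomial k X (F : functional R T) (c : R) n :
  adm X -> adm F ->
  E k (X * (F + cst c) ^+ n) =
  \sum_(i < n.+1) E k (X * F ^+ (n - i)) * cst (c ^+ i) *+ 'C(n, i).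
Proof.
move=> aX aF.
have aXF i : adm (X * F ^+ (n - i)) by apply: admissibleM => //; exact: admissibleX.
have aXFc i : adm (X * F ^+ (n - i) * cst (c ^+ i)).
  exact: admissibleM (admissible_cst _ _ _).
rewrite exprDn mulr_sumr.
have cstX i : cst c ^+ i = cst (c ^+ i) :> functional R T by rewrite exprfctE.
under eq_bigr => i _.
  rewrite mulrnAr mulrA cstX.
  over.
rewrite (@partial_expectation_sum _ _ _ _ _ _ _ N).
  apply: eq_bigr => i _.
  by rewrite (partial_expectationMn _ _ (aXFc i)) (partial_expectation_cstM _ _ (aXF i)).
by move=> i _; exact: admissibleMn.
Qed.

(** Since [E k Y] does not see the coordinate [k], the difference of two values of [D k Y] on a
    fibre is that of [Y]. Writing it with [D k Y] exhibits [b] factors of order 1. *)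
Lemma transferE k b X x : adm X ->
  transfer k b X x = E k (M k X * (D k Y + cst (- D k Y x)) ^+ b) x.
Proof.
move=> aX; rewrite partial_expectation_binomial; first last.
- exact: admissible_glauber.
- exact: admissible_increment.
rewrite /transfer !fct_sumE; apply: eq_bigr => i _.
rewrite !natmulfctE !mulrfctE !exprfctE !opprfctE/=.
by rewrite mulrC.
Qed.

Lemma partial_expectation_fibre k (F G G' : functional R T) x n :
  (forall a, G [eta x with k |-> a] = G' [eta x with k |-> a]) ->
  E k (F * G ^+ n) x = E k (F * G' ^+ n) x.
Proof.
move=> GG'; rewrite !partial_expectationE; apply: eq_Rintegral => w _.
by rewrite !mulrfctE !exprfctE GG'.
Qed.

Lemma partial_expectation_transfer k n X : adm X ->
  E k (M k X * Y ^+ n) =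
  \sum_(b < n) transfer k b.+1 X * Y ^+ (n - b.+1) *+ 'C(n, b.+1).
Proof.
move=> aX; apply/funext => x.
have aM := admissible_increment k aX; have aD := admissible_glauber z k aY.
(* On the fibre through [x], Y(x') = (D_k Y(x') - D_k Y(x)) + Y(x), and Y(x) is a constant there. *)
rewrite (@partial_expectation_fibre k _ _
    ((D k Y + cst (- D k Y x)) + cst (Y x))); last first.
  move=> a; rewrite !addrfctE/= !glauberE !addrfctE !opprfctE.
  rewrite partial_expectation_replace; ring.
rewrite partial_expectation_binomial//; last exact: admissibleD (admissible_cst _ _ _).
(* After reversal the index counts the differences Y' - Y; the term without any vanishes because the
   increment averages to zero in the coordinate [k]. *)
rewrite (reindex_inj rev_ord_inj) big_ord_recl/= subSS subn0 subnn expr0 mulr1.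
rewrite partial_expectation_increment// mul0r mul0rn add0r !fct_sumE.
have YX m : (Y ^+ m) x = Y x ^+ m by rewrite exprfctE.
apply: eq_bigr => b _; rewrite !natmulfctE /bump/= add1n subSS.
rewrite -[LHS]/(E k _ x * Y x ^+ _ *+ _).
rewrite -[RHS]/(transfer k b.+1 X x * (Y ^+ _) x *+ _) YX transferE//.
by rewrite subKn ?bin_sub ?ltn_ord.
Qed.

Lemma meanMn X n : adm X -> mean (X *+ n) = mean X *+ n.
Proof.
move=> aX; elim: n => [|n IH]; first by rewrite !mulr0n (mean_cst 0).
by rewrite !mulrS meanD ?IH//; exact: admissibleMn.
Qed.

Lemma mean_mulX_recursion n X : adm X ->
  mean (X * Y ^+ n) = mean X * mean (Y ^+ n) +
  \sum_(k < N) \sum_(b < n)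
    mean (transfer k b.+1 X * Y ^+ (n - b.+1)) *+ 'C(n, b.+1).
Proof.
move=> aX; have aYX m : adm (Y ^+ m) by exact: admissibleX.
have aM k : adm (M k X) by exact: admissible_increment.
have aT k b : adm (transfer k b X) by exact: admissible_transfer.
rewrite [X in mean (X * _)](martingale_decomposition aX) mulrDl meanD; first last.
- by apply: admissibleM => //; apply: admissible_sum.
- exact: admissibleM (admissible_cst _ _ _) _.
rewrite meanZ// mulr_suml mean_sum; last by move=> k _; exact: admissibleM.
congr (_ + _); apply: eq_bigr => k _.
rewrite -(@mean_partial_expectation _ _ _ _ _ _ _ N z_indep k); last exact: admissibleM.
rewrite partial_expectation_transfer// mean_sum; last first.
  by move=> b _; apply: admissibleMn; exact: admissibleM.
by apply: eq_bigr => b _; rewrite meanMn//; exact: admissibleM.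
Qed.

(* kappa(X, Y, ..., Y) with n copies of Y; a junk value unless n <= fuel. *)
Fixpoint joint_cumulant_rec fuel n X : R :=
  if n is n'.+1 then
    if fuel is fuel'.+1 then
      \sum_(k < N) \sum_(b < n'.+1)
        joint_cumulant_rec fuel' (n' - b)%N (transfer k b.+1 X) *+ 'C(n'.+1, b.+1)
    else 0
  else mean X.

Definition joint_cumulant n X := joint_cumulant_rec n n X.

Lemma joint_cumulant_recE fuel n X : (n <= fuel)%N ->
  joint_cumulant_rec fuel n X = joint_cumulant n X.
Proof.
rewrite /joint_cumulant.
elim: n {-2}n (leqnn n) fuel X => [|m IH] [|n]//= nm [|fuel]//= X nf.
apply: eq_bigr => k _; apply: eq_bigr => b _.
have nb : (n - b <= n)%N by exact: leq_subr.
have nm' : (n <= m)%N by [].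
have nf' : (n <= fuel)%N by [].
by rewrite (IH _ (leq_trans nb nm') _ _ (leq_trans nb nf')) (IH _ (leq_trans nb nm') _ _ nb).
Qed.

Lemma joint_cumulantS n X :
  joint_cumulant n.+1 X = \sum_(k < N) \sum_(b < n.+1)
    joint_cumulant (n - b) (transfer k b.+1 X) *+ 'C(n.+1, b.+1).
Proof.
rewrite {1}/joint_cumulant/=; apply: eq_bigr => k _; apply: eq_bigr => b _.
by rewrite joint_cumulant_recE// leq_subr.
Qed.

(** This moment-cumulant formula is what identifies the recursively defined numbers. The moments of
    each [transfer k b.+1 X] are expanded by induction, and the product of binomials is regrouped by
    [bin_mul_bin]. *)
Lemma moment_joint_cumulant n X : adm X ->
  mean (X * Y ^+ n) =
  \sum_(i < n.+1) joint_cumulant i X * mean (Y ^+ (n - i)) *+ 'C(n, i).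
Proof.
elim: n {-2}n (leqnn n) X => [|m IH] n nm X aX.
  move: nm; rewrite leqn0 => /eqP->.
  by rewrite big_ord1 subnn !expr0 (mean_cst 1) !mulr1.
rewrite mean_mulX_recursion// big_ord_recl/= subn0 bin0 mulr1n; congr (_ + _).
pose F k b j := joint_cumulant j (transfer k b.+1 X) *
  mean (Y ^+ (n - b.+1 - j)) *+ ('C(n, b.+1) * 'C(n - b.+1, j)).
transitivity (\sum_(k < N) \sum_(b < n) \sum_(j < n - b) F k b j).
  apply: eq_bigr => k _; apply: eq_bigr => b _.
  rewrite IH; first last.
  - exact: admissible_transfer.
  - by rewrite -ltnS (leq_trans _ nm)// ltn_subrL/= (leq_ltn_trans _ (ltn_ord b)).
  rewrite -sumrMnl (_ : (n - b = (n - b.+1).+1)%N) ?subnSK//.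
  by apply: eq_bigr => j _; rewrite /F -mulrnA mulnC.
transitivity (\sum_(k < N) \sum_(i < n) \sum_(b < i.+1) F k b (i - b)%N).
  by apply: eq_bigr => k _; exact: sum_triangle.
rewrite exchange_big/=; apply: eq_bigr => i _.
rewrite joint_cumulantS mulr_suml -sumrMnl; apply: eq_bigr => k _.
rewrite mulr_suml -sumrMnl; apply: eq_bigr => b _.
rewrite /F /bump/= add1n mulrnAl -mulrnA.
have bi : (b <= i)%N by rewrite -ltnS.
have iN := ltn_ord i.
rewrite (_ : (n - b.+1 - (i - b) = n - i.+1)%N); last lia.
congr (_ *+ _).
rewrite bin_mul_bin; last lia.
by rewrite addSn subnKC// mulnC.
Qed.

End joint_cumulant.

(** * Norms indexed by order, and finiteness of the Glauber norms *)

Section order_norm.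
Context (R : realType) (dO : measure_display) (Omega : measurableType dO).
Context (P : probability Omega R).
Context (dT : measure_display) (T : measurableType dT).
Context (z : nat -> {RV P >-> T}) (N : nat).
Hypothesis z_indep : mutually_independent z.
Implicit Types (X Y : functional R T) (k l : nat) (x y : nat -> T).

Local Notation E := (partial_expectation z).
Local Notation D := (glauber z).
Local Notation adm := (@admissible R dT T N).
Local Notation mean := (mean z).

(* The L^{Q/a} norm: in a product of total order Q, a factor of order a gets  *)
(* the exponent Q/a, and Hoelder's inequality makes orders additive.          *)
Definition order_norm (Q a : nat) X : R :=
  Lp P (Q%:R / a%:R) (eval_data z X).

Local Notation nu := order_norm.

Variable Q : nat.

Lemma order_norm_ge0 a X : 0 <= nu Q a X.
Proof. exact: Lp_ge0. Qed.

Lemma order_exponent_ge1 a : (0 < a <= Q)%N -> 1 <= Q%:R / a%:R :> R.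
Proof. by move=> /andP[a0 aQ]; rewrite ler_pdivlMr ?ltr0n// mul1r ler_nat. Qed.

Lemma order_normD a X Y : (0 < a <= Q)%N -> adm X -> adm Y ->
  nu Q a (X + Y) <= nu Q a X + nu Q a Y.
Proof.
move=> aQ aX aY.
rewrite /order_norm (_ : eval_data z (X + Y) = eval_data z X + eval_data z Y)//.
exact: (ler_LpD _ (order_exponent_ge1 aQ) (admissible_eval z aX) (admissible_eval z aY)).
Qed.

Lemma order_normM a b X Y : (0 < a)%N -> (0 < b)%N -> (0 < Q)%N ->
  adm X -> adm Y -> nu Q (a + b) (X * Y) <= nu Q a X * nu Q b Y.
Proof.
move=> a0 b0 Q0 aX aY.
have pos c : (0 < c)%N -> 0 < Q%:R / c%:R :> R by move=> c0; rewrite divr_gt0 ?ltr0n.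
rewrite /order_norm (_ : eval_data z (X * Y) = eval_data z X * eval_data z Y)//.
apply: (ler_LpM _ (pos _ a0) (pos _ b0) _ _ (admissible_eval z aX) (admissible_eval z aY)).
  by rewrite pos// addn_gt0 a0.
by rewrite !invf_div -mulrDl natrD.
Qed.

(** Jensen in the integrated coordinate, pointwise in the others, followed by invariance of the mean
    under [E k]. Jensen needs Q/a >= 1, hence the condition [a <= Q]. *)
Lemma order_norm_partial_expectation a k X : (0 < a <= Q)%N -> adm X -> nu Q a (E k X) <= nu Q a X.
Proof.
move=> aQ aX; have p1 := order_exponent_ge1 aQ.
set p := _ / _ in p1; have p0 : 0 < p := lt_le_trans ltr01 p1.
rewrite /order_norm -/p !LpE; apply: ge0_ler_powR.
- by rewrite invr_ge0 ltW.
- by rewrite nnegrE; apply: Rintegral_ge0 => w _; exact: powR_ge0.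
- by rewrite nnegrE; apply: Rintegral_ge0 => w _; exact: powR_ge0.
have aXp := admissible_abs_powR (ltW p0) aX.
rewrite -[leRHS]/(mean (fun x => `|X x| `^ p)).
rewrite -(mean_partial_expectation z_indep k aXp).
apply: ler_Rintegral.
- apply: bounded_measurable_powR (ltW p0) _.
  exact: (@admissible_eval _ _ _ _ _ _ z N _ (admissible_partial_expectation z k aX)).
- exact: (@admissible_eval _ _ _ _ _ _ z N _ (admissible_partial_expectation z k aXp)).
move=> w; rewrite /eval_data !partial_expectationE.
exact: (ler_norm_Rintegral_powR _ p1 (admissible_section z _ k aX)).
Qed.

Lemma order_normN a X : nu Q a (- X) = nu Q a X.
Proof.
rewrite /order_norm !LpE; congr (_ `^ _); apply: eq_Rintegral => w _.
by rewrite /eval_data opprfctE normrN.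
Qed.

Lemma order_norm_glauber a k X : (0 < a <= Q)%N -> adm X ->
  nu Q a (D k X) <= 2 * nu Q a X.
Proof.
move=> aQ aX; rewrite glauberE; apply: (le_trans (order_normD aQ aX _)).
  exact/admissibleN/admissible_partial_expectation.
by rewrite order_normN mulr_natl mulr2n lerD2l; exact: order_norm_partial_expectation.
Qed.

Lemma order_norm0 a : (0 < a)%N -> (0 < Q)%N -> nu Q a 0 = 0.
Proof.
move=> a0 Q0; rewrite /order_norm LpE.
have p0 : Q%:R / a%:R != 0 :> R by rewrite mulf_neq0 ?invr_neq0// pnatr_eq0 -lt0n.
rewrite (_ : (fun w => _) = cst 0); last first.
  by apply/funext => w; rewrite normr0 powR0.
by rewrite Rintegral_prob_cst powR0// invr_neq0.
Qed.

Lemma order_norm_iter a s X : (0 < a <= Q)%N -> adm X ->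
  nu Q a (iter_glauber z s X) <= 2 ^+ size s * nu Q a X.
Proof.
move=> aQ aX; elim: s => [|k s IH]; first by rewrite expr0 mul1r.
rewrite exprS -mulrA; apply: le_trans (ler_wpM2l _ IH); last by [].
exact/order_norm_glauber/admissible_iter.
Qed.

Lemma ler_norm_mean X : (0 < Q)%N -> adm X -> `|mean X| <= nu Q Q X.
Proof.
move=> Q0 aX; rewrite /order_norm divff ?pnatr_eq0 -?lt0n// Lp1.
apply: le_normr_Rintegral => //.
exact: bounded_measurable_integrable (admissible_eval z aX).
Qed.

Variable Y : functional R T.
Hypothesis aY : adm Y.

Definition order_glauber_norm a : R := fine (glauber_norm z a (Q%:R / a%:R) Y).

Lemma Lnorm_order_norm a X : adm X ->
  Lnorm P (Q%:R / a%:R)%:E (EFin \o eval_data z X) = (nu Q a X)%:E.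
Proof.
by move=> aX; rewrite Lnorm_Lp// ?divr_ge0//; exact: (admissible_eval z aX).
Qed.

(** The crude bound 2^a times the norm of [Y] makes the supremum finite, so the argument can stay in
    the real numbers. *)
Lemma glauber_norm_fin_num a : (0 < a <= Q)%N ->
  glauber_norm z a (Q%:R / a%:R) Y = (order_glauber_norm a)%:E.
Proof.
move=> aQ; rewrite /order_glauber_norm fineK// fin_real//; apply/andP; split.
  apply: (@lt_le_trans _ _ 0%E) => //; apply: le_trans (ereal_sup_ubound _).
    exact: (Lnorm_ge0 P (Q%:R / a%:R)%:E (EFin \o eval_data z (iter_glauber z (iota 0 a) Y))).
  by exists (iota 0 a) => //; rewrite /= size_iota iota_uniq.
apply: (@le_lt_trans _ _ (2 ^+ a * nu Q a Y)%:E); last exact: ltry.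
apply: ge_ereal_sup => _ [s [sa us] <-].
rewrite (Lnorm_order_norm _ (admissible_iter z s aY)) lee_fin.
by move: (order_norm_iter s aQ aY); rewrite -sa.
Qed.

Lemma order_glauber_norm_ge0 a : 0 <= order_glauber_norm a.
Proof.
apply: fine_ge0; apply: le_trans (ereal_sup_ubound _); last first.
  by exists (iota 0 a) => //; rewrite /= size_iota iota_uniq.
exact: Lnorm_ge0.
Qed.

Lemma ler_order_glauber_norm s : uniq s -> (0 < size s <= Q)%N ->
  nu Q (size s) (iter_glauber z s Y) <= order_glauber_norm (size s).
Proof.
move=> us sQ; rewrite -lee_fin -glauber_norm_fin_num//.
rewrite -(Lnorm_order_norm _ (admissible_iter z s aY)).
by apply: ereal_sup_ubound; exists s.
Qed.

End order_norm.

(** * Functionals bounded like products of Glauber derivatives *)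

Section controlled.
Context (R : realType) (dO : measure_display) (Omega : measurableType dO).
Context (P : probability Omega R).
Context (dT : measure_display) (T : measurableType dT).
Context (z : nat -> {RV P >-> T}) (N : nat).
Hypothesis z_indep : mutually_independent z.
Implicit Types (X : functional R T) (k l : nat) (x : nat -> T).

Local Notation E := (partial_expectation z).
Local Notation D := (glauber z).
Local Notation adm := (@admissible R dT T N).
Local Notation nu := (order_norm z).
Local Notation M := (martingale_increment z N).

Variable Y : functional R T.
Hypothesis aY : adm Y.

(** A generating polynomial: the coefficient of degree o in its s-th power is the sum over a_1 + ...
    + a_s = o in the theorem ([order_sumE]). The zero constant coefficient encodes a_j >= 1, and the
    cut at degree [Q] keeps the exponents Q/a at least 1. *)
Definition order_poly Q : {poly R} :=
  \poly_(i < Q.+1) if (0 < i)%N then order_glauber_norm z Q Y i else 0.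

Definition order_sum s Q o : R := (order_poly Q ^+ s)`_o.

Lemma order_poly_ge0 Q o : 0 <= (order_poly Q)`_o.
Proof.
rewrite coef_poly; case: ifP => // _; case: ifP => // _.
exact: order_glauber_norm_ge0.
Qed.

Lemma order_sum_ge0 s Q o : 0 <= order_sum s Q o.
Proof.
rewrite /order_sum; elim: s o => [|s IH] o; first by rewrite expr0 coef1 ler0n.
rewrite exprS coefM; apply: sumr_ge0 => i _.
by rewrite mulr_ge0 ?order_poly_ge0.
Qed.

(** The left side is one term of the convolution giving the coefficient on the right, and the other
    terms are non-negative. *)
Lemma ler_order_sumM s s' Q o o' :
  order_sum s Q o * order_sum s' Q o' <= order_sum (s + s') Q (o + o').
Proof.
rewrite [leRHS]/order_sum exprD coefM.
have oo : (o < (o + o').+1)%N by rewrite ltnS leq_addr.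
rewrite (bigD1 (Ordinal oo))//= addKn lerDl; apply: sumr_ge0 => i _.
by rewrite mulr_ge0 ?order_sum_ge0.
Qed.

Lemma order_sum1 Q o : (0 < o <= Q)%N ->
  order_sum 1 Q o = order_glauber_norm z Q Y o.
Proof. by move=> /andP[ o0 oQ]; rewrite /order_sum expr1 coef_poly ltnS oQ o0. Qed.

(* X behaves like a product of s Glauber derivatives of Y of total order o,   *)
(* the coordinates in K being used up; r bounds the number of further         *)
(* derivatives.                                                               *)
Definition controlled (K : seq nat) (s o : nat) (A : R) (r : nat) X :=
  [/\ adm X, 0 <= A, (0 < o)%N &
      forall Q L, uniq L -> {in L, forall l, l \notin K} -> (size L <= r)%N ->
        (size L + o <= Q)%N ->
        nu Q (size L + o) (iter_glauber z L X) <= A * order_sum s Q (size L + o)].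

Lemma controlled_sub K K' s o A A' r r' X : {subset K <= K'} -> A <= A' ->
  (r' <= r)%N -> controlled K s o A r X -> controlled K' s o A' r' X.
Proof.
move=> KK' AA' rr' [aX A0 o0 HX]; split=> //; first exact: le_trans AA'.
move=> Q L uL LK' Lr LQ; apply: le_trans (HX Q L uL _ _ LQ) _ => //.
- by move=> l lL; apply: contra (LK' l lL); exact: KK'.
- exact: leq_trans rr'.
- by rewrite ler_wpM2r// order_sum_ge0.
Qed.

Lemma addn_gt0r a b : (0 < b)%N -> (0 < a + b)%N.
Proof. by rewrite addn_gt0 orbC => ->. Qed.

Lemma controlledD K s o A A' r X X' : controlled K s o A r X ->
  controlled K s o A' r X' -> controlled K s o (A + A') r (X + X').
Proof.
move=> [aX A0 o0 HX] [aX' A0' _ HX']; split=> //.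
- exact: admissibleD.
- exact: addr_ge0.
move=> Q L uL LK Lr LQ; rewrite (@iter_glauberD _ _ _ _ _ _ _ N)//.
apply: le_trans (@order_normD _ _ _ _ _ _ _ N _ _ _ _ _ _ _) _.
- by rewrite addn_gt0r.
- exact: admissible_iter.
- exact: admissible_iter.
by rewrite mulrDl lerD ?HX ?HX'.
Qed.

Lemma controlled0 K s o r : (0 < o)%N -> controlled K s o 0 r 0.
Proof.
move=> o0; split=> //.
move=> Q L _ _ _ LQ; rewrite mul0r (_ : iter_glauber z L 0 = 0).
  by rewrite order_norm0 ?(leq_trans _ LQ) ?addn_gt0r.
by elim: L {LQ} => //= l L ->; exact: glauber0.
Qed.

Lemma controlledMn K s o A r X n : controlled K s o A r X ->
  controlled K s o (A *+ n) r (X *+ n).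
Proof.
move=> HX; elim: n => [|n IH].
  by rewrite !mulr0n; apply: controlled0; case: HX.
by rewrite !mulrS; exact: controlledD.
Qed.

Lemma controlled_sum K s o r (I : Type) (t : seq I) (A : I -> R)
    (F : I -> functional R T) : (0 < o)%N ->
  (forall i, controlled K s o (A i) r (F i)) ->
  controlled K s o (\sum_(i <- t) A i) r (\sum_(i <- t) F i).
Proof.
move=> o0 HF; elim: t => [|i t IH]; first by rewrite !big_nil; exact: controlled0.
by rewrite !big_cons; exact: controlledD.
Qed.

Lemma controlledN K s o A r X : controlled K s o A r X ->
  controlled K s o A r (- X).
Proof.
move=> [aX A0 o0 HX]; split=> //; first exact: admissibleN.
move=> Q L uL LK Lr LQ; rewrite (_ : iter_glauber z L (- X) = - iter_glauber z L X).
  by rewrite order_normN HX.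
have := @iter_glauberD _ _ _ _ _ _ z N L X (- X) aX (admissibleN aX).
rewrite subrr (_ : iter_glauber z L 0 = 0).
  by move/esym/eqP; rewrite addrC addr_eq0 => /eqP.
by elim: L {uL LK Lr LQ} => //= l L ->; exact: glauber0.
Qed.

Lemma controlled_partial_expectation K s o A r k X : controlled K s o A r X ->
  controlled K s o A r (E k X).
Proof.
move=> [aX A0 o0 HX]; split=> //; first exact: admissible_partial_expectation.
move=> Q L uL LK Lr LQ; rewrite -(@partial_expectation_iterC _ _ _ _ _ _ _ N)//.
apply: le_trans (@order_norm_partial_expectation _ _ _ _ _ _ _ N z_indep _ _ _ _ _ _) (HX _ _ _ _ _ _) => //.
- by rewrite addn_gt0r.
- exact: admissible_iter.
Qed.

(** Meant for a coordinate already in [K], where no order can be gained. *)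
Lemma controlled_glauber K s o A r k X : controlled K s o A r X ->
  controlled K s o (2 * A) r (D k X).
Proof.
by move=> HX; rewrite glauberE mulr_natl mulr2n; apply: controlledD => //;
  apply/controlledN/controlled_partial_expectation.
Qed.

(** The new derivative is charged to the list: the bound for [X] is used with [k :: L], which takes
    one of its r + 1 allowed derivatives. *)
Lemma controlled_glauber_gain K s o A r k X : k \notin K -> controlled K s o A r.+1 X ->
  controlled (k :: K) s o.+1 A r (D k X).
Proof.
move=> kK [aX A0 o0 HX]; split=> //; first exact: admissible_glauber.
move=> Q L uL LK Lr LQ; rewrite -(@glauber_iterC _ _ _ _ _ _ _ N)//.
rewrite addnS -addSn; apply: (HX Q (k :: L)) => //=.
- rewrite uL andbT; apply/negP => kL.
  by have := LK k kL; rewrite inE eqxx.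
- move=> l; rewrite inE => /orP[/eqP->//|/LK]; rewrite inE.
  by rewrite negb_or => /andP[].
- by rewrite addSn -addnS.
Qed.

(** Induction on the list of derivatives. By [glauberM] its head falls on one of the two factors,
    raising the order of that factor by one, and joins the used coordinates; each derivative costs
    3. Without derivatives this is Hoelder together with [ler_order_sumM]. *)
Lemma controlledM K s o A r X s' o' A' X' :
  controlled K s o A r X -> controlled K s' o' A' r X' ->
  controlled K (s + s') (o + o') (3 ^+ r * (A * A')) r (X * X').
Proof.
move=> HX HX'; have [[aX A0 o0 _] [aX' A0' o0' _]] := (HX, HX').
split; first exact: admissibleM.
- by rewrite !mulr_ge0// exprn_ge0.
- by rewrite addn_gt0 o0.
move=> Q L; elim: L r K o o' X X' HX HX' aX aX' o0 o0' => [|l L IH]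
    r K o o' X X' HX HX' aX aX' o0 o0' uL LK Lr LQ /=.
  have [[_ _ _ bX] [_ _ _ bX']] := (HX, HX').
  rewrite add0n in LQ *.
  have oQ : (o <= Q)%N by rewrite (leq_trans _ LQ)// leq_addr.
  have oQ' : (o' <= Q)%N by rewrite (leq_trans _ LQ)// leq_addl.
  have {}bX := bX Q [::] isT (fun _ => ltac:(by [])) (leq0n _) oQ.
  have {}bX' := bX' Q [::] isT (fun _ => ltac:(by [])) (leq0n _) oQ'.
  apply: (le_trans (order_normM _ o0 o0' (leq_trans o0 oQ) aX aX')).
  apply: (le_trans (ler_pM (order_norm_ge0 _ _ _ _) (order_norm_ge0 _ _ _ _) bX bX')).
  rewrite mulrACA; apply: le_trans (_ : A * A' * order_sum (s + s') Q (o + o') <= _).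
    by rewrite ler_wpM2l ?mulr_ge0 ?ler_order_sumM.
  rewrite ler_wpM2r ?order_sum_ge0// -[leLHS]mul1r ler_wpM2r ?mulr_ge0//.
  by rewrite exprn_ege1// ler1n.
case: r Lr HX HX' => // r Lr HX HX'.
have /andP[lL {}uL] := uL.
have lK : l \notin K by apply: LK; rewrite mem_head.
have LlK : {in L, forall l', l' \notin l :: K}.
  move=> l' l'L; rewrite inE negb_or LK ?inE ?l'L ?orbT// andbT.
  by apply: contraNneq lL => <-.
have Kl : {subset K <= l :: K} by move=> i iK; rewrite inE iK orbT.
(* One factor receives the derivative in [l]; the other is weakened to the larger list and to one
   derivative less. *)
have G1 := controlled_glauber_gain lK HX.
have G2 := controlled_glauber_gain lK HX'.
have W1 := controlled_partial_expectation l (controlled_sub Kl (lexx _) (leqnSn r) HX).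
have W2 := controlled_sub Kl (lexx _) (leqnSn r) HX'.
have aDX := admissible_glauber z l aX; have aDX' := admissible_glauber z l aX'.
have aEX := admissible_partial_expectation z l aX.
rewrite -[glauber z l _]/(D l (iter_glauber z L (X * X'))).
rewrite (@glauber_iterC _ _ _ _ _ _ _ N)//; last exact: admissibleM.
rewrite (@glauberM _ _ _ _ _ _ _ N)// (@iter_glauberD _ _ _ _ _ _ _ N); first last.
- exact: admissibleM.
- exact/admissible_glauber/admissibleM.
have LQ1 : (size L + (o.+1 + o') <= Q)%N by rewrite addSn addnS -addSn.
have LQ2 : (size L + (o + o'.+1) <= Q)%N by rewrite addnS addnS -addSn.
have := IH _ _ _ _ _ _ G1 W2 aDX aX' isT o0' uL LlK Lr LQ1.
have := IH _ _ _ _ _ _ W1 G2 aEX aDX' o0 isT uL LlK Lr LQ2.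
rewrite addSn !addnS -(addSn (size L)) => B2 B1.
have oQ : (0 < (size L).+1 + (o + o') <= Q)%N by rewrite addSn.
have aDXX' := admissibleM aDX aX'.
have aI1 := admissible_iter z L (admissible_glauber z l aDXX').
have aI2 := admissible_iter z L (admissibleM aEX aDX').
apply: (le_trans (order_normD _ oQ aI1 aI2)).
(* Brought to the front, the outer [D l] of the first term costs a factor 2; the second term adds
   1. *)
rewrite -(@glauber_iterC _ _ _ _ _ _ _ N)//.
have aI3 := admissible_iter z L aDXX'.
apply: le_trans (lerD (order_norm_glauber z_indep l oQ aI3) B2) _.
apply: le_trans (lerD (ler_wpM2l _ B1) (lexx _)) _ => //.
by rewrite exprS le_eqVlt; apply/orP; left; apply/eqP; ring.
Qed.

End controlled.

(** At most [size K] indices lie in [K], each worth u; the others, at most N, are worth u/N each. *)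
Lemma sum_mem_or_small (R : realType) (N : nat) (K : seq nat) (U : 'I_N -> R) (u : R) :
  0 <= u ->
  (forall k : 'I_N, (k : nat) \in K -> U k <= u) ->
  (forall k : 'I_N, (k : nat) \notin K -> N%:R * U k <= u) ->
  \sum_k U k <= (size K).+1%:R * u.
Proof.
move=> u0 UK UnK; rewrite (bigID (fun k : 'I_N => (k : nat) \in K))/=.
rewrite -addn1 natrD mulrDl mul1r lerD//.
  apply: (le_trans (ler_sum _ UK)); rewrite sumr_const -[leLHS]mulr_natl.
  rewrite ler_wpM2r// ler_nat.
  rewrite cardE -(size_map val).
  apply: uniq_leq_size; first by rewrite map_inj_uniq ?enum_uniq//; exact: val_inj.
  by move=> x /mapP[k]; rewrite mem_enum => kK ->.
have [N0|N0] := posnP N.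
  by rewrite big1// => k; have := ltn_ord k; rewrite {2}N0.
apply: (@le_trans _ _ (\sum_(k < N) u / N%:R)).
  rewrite [leRHS](bigID (fun k : 'I_N => (k : nat) \notin K))/=.
  apply: (@le_trans _ _ (\sum_(k < N | (k : nat) \notin K) u / N%:R)).
    by apply: ler_sum => k kK; rewrite ler_pdivlMr ?ltr0n// mulrC UnK.
  by rewrite lerDl sumr_ge0// => k _; rewrite divr_ge0.
by rewrite sumr_const card_ord -[leLHS]mulr_natr divfK// pnatr_eq0 -lt0n.
Qed.

Lemma sum_bin_le n : (\sum_(b < n) 'C(n, b.+1) <= 2 ^ n)%N.
Proof.
rewrite -(addn1 1) expnDn big_ord_recl/= bin0 !exp1n; apply: leq_trans (leq_addl _ _).
by apply: leq_sum => b _; rewrite !exp1n !muln1.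
Qed.

(** * Estimate of the joint cumulants *)

Section joint_cumulant_bound.
Context (R : realType) (dO : measure_display) (Omega : measurableType dO).
Context (P : probability Omega R).
Context (dT : measure_display) (T : measurableType dT).
Context (z : nat -> {RV P >-> T}) (N : nat).
Hypothesis z_indep : mutually_independent z.
Implicit Types (X : functional R T) (k l : nat) (x : nat -> T).

Local Notation E := (partial_expectation z).
Local Notation D := (glauber z).
Local Notation adm := (@admissible R dT T N).
Local Notation M := (martingale_increment z N).

Variable Y : functional R T.
Hypothesis aY : adm Y.

Local Notation controlled := (controlled z N Y).
Local Notation S := (order_sum z Y).

(** Since [L] avoids [k], differentiating [D k Y] along [L] differentiates [Y] along distinct
    coordinates [k :: L], as in the Glauber norm. *)
Lemma controlled_glauber_self k r : controlled [:: k] 1 1 1 r (D k Y).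
Proof.
split => //; first exact: admissible_glauber.
move=> Q L uL Lk Lr LQ; rewrite -(@glauber_iterC _ _ _ _ _ _ _ N)//.
have LQ' : (0 < (size L).+1 <= Q)%N by move: LQ; rewrite addn1.
rewrite addn1 mul1r order_sum1//.
apply: (@ler_order_glauber_norm _ _ _ _ _ _ _ N z_indep _ _ aY (k :: L)) => //.
rewrite /= uL andbT; apply/negP => kL.
by have := Lk k kL; rewrite inE eqxx.
Qed.

Lemma controlled_tail K s o A r k X : controlled K s o A r X ->
  controlled K s o A r (tail_expectation z N k X).
Proof.
move=> HX; rewrite /tail_expectation; elim: (iota _ _) => //= l t.
exact: controlled_partial_expectation.
Qed.

Lemma controlledMX K s o A r X k j : k \in K -> controlled K s o A r X ->
  controlled K (s + j) (o + j) ((3 ^+ r) ^+ j * A) r (X * D k Y ^+ j).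
Proof.
move=> kK HX; elim: j => [|j IH].
  by rewrite !addn0 !expr0 mul1r mulr1.
have HD : controlled K 1 1 1 r (D k Y).
  by apply: controlled_sub (controlled_glauber_self k r) => // l; rewrite inE => /eqP->.
have := controlledM z_indep HD IH.
by rewrite !addnS mul1r !exprS !mulrA [D k Y * X]mulrC -mulrA.
Qed.

Lemma controlled_transfer K s o A r k b X : k \in K -> adm X ->
  controlled K s o A r (M k X) ->
  controlled K (s + b) (o + b) (2 ^+ b * (3 ^+ r) ^+ b * A) r (transfer z N Y k b X).
Proof.
move=> kK aX HM.
have o0 : (0 < o + b)%N by rewrite addn_gt0; case: HM => _ _ ->.
(* Each summand contains [b] multiplications by [D k Y], each costing [3 ^+ r]; the binomial weights
   add up to [2 ^+ b]. *)
rewrite (_ : 2 ^+ b * (3 ^+ r) ^+ b * A =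
  \sum_(i < b.+1) ((3 ^+ r) ^+ b * A) *+ 'C(b, i)).
  apply: controlled_sum => // i; apply: controlledMn.
  have ib : (i <= b)%N by rewrite -ltnS.
  have := controlled_partial_expectation z_indep k (controlledMX (b - i) kK HM).
  move=> /(controlledMX i kK).
  rewrite -!addnA subnK// mulrA -exprD subnKC//.
  have [bs|bs] := boolP (odd i).
    move=> /controlledN; rewrite exprNn -signr_odd bs expr1 mulN1r mulNr.
    by rewrite [_ ^+ i * _]mulrC.
  by rewrite exprNn -signr_odd (negbTE bs) expr0 mul1r [_ ^+ i * _]mulrC.
rewrite sumrMnr -mulrA -[RHS]mulr_natl; congr (_ * _).
rewrite -natrX; congr (_%:R).
rewrite -(addn1 1) expnDn; apply: eq_bigr => i _.
by rewrite !exp1n !muln1.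
Qed.

(** Here v counts the fresh coordinates still to come: each brings a factor N from its sum and one
    more unit of total order. *)
Definition order_series s o n : R :=
  \sum_(v < n.+1) N%:R ^+ v * S s (o + v) (o + v).

Lemma order_series_ge0 s o n : 0 <= order_series s o n.
Proof.
by apply: sumr_ge0 => v _; rewrite mulr_ge0 ?exprn_ge0// order_sum_ge0.
Qed.

Lemma ler_order_series s o n n' : (n' <= n)%N ->
  order_series s o n' <= order_series s o n.
Proof.
move=> n'n; rewrite /order_series.
rewrite -[leLHS](big_mkord xpredT (fun v => N%:R ^+ v * S s (o + v) (o + v))).
rewrite -[leRHS](big_mkord xpredT (fun v => N%:R ^+ v * S s (o + v) (o + v))).
rewrite [leRHS](@big_cat_nat _ _ _ n'.+1)//= lerDl; apply: sumr_ge0 => v _.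
by rewrite mulr_ge0 ?exprn_ge0// order_sum_ge0.
Qed.

(** The factor N and the raised order together shift the index v by one, so the left side is part of
    the series on the right. *)
Lemma ler_order_seriesS s o n n' : (n' < n)%N ->
  N%:R * order_series s o.+1 n' <= order_series s o n.
Proof.
move=> n'n; apply: le_trans (ler_order_series _ _ n'n).
rewrite /order_series mulr_sumr [leRHS]big_ord_recl/= -[leLHS]add0r lerD//.
  by rewrite mulr_ge0 ?exprn_ge0// order_sum_ge0.
by rewrite le_eqVlt; apply/orP; left; apply/eqP; apply: eq_bigr => v _;
  rewrite mulrA -exprS addSnnS.
Qed.

Variable m : nat.

(** The constant of [controlled_transfer] for b, r at most m; the last 2 pays for a [D k] in a used
    coordinate. *)
Definition transfer_constant : R := 2 ^+ m * (3 ^+ m) ^+ m * 2.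

(** The factor m + 1 bounds [(size K).+1] from [sum_mem_or_small], and [2 ^+ m] the sum of the
    binomial weights. *)
Definition step_constant : R := m.+1%:R * 2 ^+ m * transfer_constant.

Lemma transfer_constant_ge1 : 1 <= transfer_constant.
Proof.
by rewrite /transfer_constant !mulr_ege1// ?exprn_ege1// ?exprn_ege1// ler1n.
Qed.

Lemma step_constant_ge1 : 1 <= step_constant.
Proof.
rewrite /step_constant; apply: mulr_ege1 transfer_constant_ge1.
by apply: mulr_ege1; [rewrite ler1n|apply: exprn_ege1; rewrite ler1n].
Qed.

Lemma ler_transfer_constant (A : R) b r : 0 <= A -> (b <= m)%N -> (r <= m)%N ->
  2 ^+ b * (3 ^+ r) ^+ b * (2 * A) <= transfer_constant * A.
Proof.
move=> A0 bm rm; rewrite /transfer_constant mulrA ler_wpM2r// ler_wpM2r//.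
rewrite ler_pM ?exprn_ge0 ?ler_weXn2l ?ler1n//.
apply: (@le_trans _ _ ((3 ^+ m) ^+ b)).
  by rewrite lerXn2r ?nnegrE ?exprn_ge0// ler_weXn2l// ler1n.
by rewrite ler_weXn2l// exprn_ege1// ler1n.
Qed.

Lemma controlled_transfer_in K s o A r k b X : k \in K -> (b <= m)%N ->
  (r <= m)%N -> controlled K s o A r X ->
  controlled K (s + b) (o + b) (transfer_constant * A) r (transfer z N Y k b X).
Proof.
move=> kK bm rm HX; have [aX A0 _ _] := HX.
have := controlled_transfer b kK aX (controlled_tail k.+1 (controlled_glauber z_indep k HX)).
by apply: controlled_sub => //; exact: ler_transfer_constant.
Qed.

Lemma controlled_transfer_out K s o A r k b X : k \notin K -> (b <= m)%N ->
  (r <= m)%N -> controlled K s o A r.+1 X ->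
  controlled (k :: K) (s + b) (o + b).+1 (transfer_constant * A) r
    (transfer z N Y k b X).
Proof.
move=> kK bm rm HX; have [aX A0 _ _] := HX.
have := controlled_transfer b (mem_head k K) aX
  (controlled_tail k.+1 (controlled_glauber_gain kK HX)).
rewrite addSn; apply: controlled_sub => //.
apply: le_trans (ler_transfer_constant A0 bm rm).
by rewrite ler_wpM2l ?mulr_ge0 ?exprn_ge0 ?exprn_ge0// ler_peMl// ler1n.
Qed.

Lemma controlled_mean K s o A r X : controlled K s o A r X ->
  `|mean z X| <= A * S s o o.
Proof.
move=> [aX A0 o0 HX]; apply: (le_trans (ler_norm_mean _ o0 aX)).
by have := HX o [::] isT (fun _ => ltac:(by [])) (leq0n _) (leqnn _); rewrite add0n.
Qed.

(** A step lowers [n] by at least one and adds at most one coordinate to [K], so [n + q] never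
    grows. As each remaining step takes at most one further derivative, [n] of them suffice. *)
Lemma joint_cumulant_bound n q K s o A X : (n + q <= m)%N -> (size K <= q)%N ->
  controlled K s o A n X ->
  `|joint_cumulant z N Y n X| <=
    A * step_constant ^+ n * order_series (s + n) (o + n) n.
Proof.
elim: n {-2}n (leqnn n) q K s o A X => [|j IH] n nj q K s o A X nqm Kq HX.
  move: nj HX; rewrite leqn0 => /eqP-> HX.
  rewrite /order_series big_ord1 !addn0 expr0 expr0 mulr1 mul1r.
  exact: controlled_mean HX.
case: n nj nqm HX => [|n] nj nqm HX.
  rewrite /order_series big_ord1 !addn0 expr0 expr0 mulr1 mul1r.
  exact: controlled_mean HX.
have [aX A0 o0 _] := HX.
set Z := order_series _ _ _.
have Z0 : 0 <= Z by exact: order_series_ge0.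
have W1 := step_constant_ge1.
have W0 : 0 <= step_constant by rewrite (le_trans ler01).
have c0 : 0 <= transfer_constant by rewrite (le_trans ler01 transfer_constant_ge1).
pose u := transfer_constant * A * step_constant ^+ n * Z.
have u0 : 0 <= u by rewrite !mulr_ge0// exprn_ge0.
have nm : (n.+1 <= m)%N by rewrite (leq_trans _ nqm)// leq_addr.
have Wn b : step_constant ^+ (n - b) <= step_constant ^+ n.
  by rewrite ler_weXn2l// leq_subr.
rewrite joint_cumulantS.
pose U (k : 'I_N) := \sum_(b < n.+1)
  `|joint_cumulant z N Y (n - b) (transfer z N Y k b.+1 X)| *+ 'C(n.+1, b.+1).
have U2 (v : R) (F : 'I_n.+1 -> R) : 0 <= v -> (forall b, F b <= v) ->
    \sum_(b < n.+1) F b *+ 'C(n.+1, b.+1) <= 2 ^+ n.+1 * v.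
  move=> v0 Fv.
  apply: (@le_trans _ _ (\sum_(b < n.+1) v *+ 'C(n.+1, b.+1))).
    by apply: ler_sum => b _; rewrite lerMn2r Fv orbT.
  rewrite sumrMnr -[leLHS]mulr_natl ler_wpM2r// -natrX ler_nat.
  exact: sum_bin_le.
apply: (@le_trans _ _ (\sum_k U k)).
  apply: (le_trans (ler_norm_sum _ _ _)); apply: ler_sum => k _.
  apply: (le_trans (ler_norm_sum _ _ _)); apply: ler_sum => b _.
  by rewrite normrMn.
apply: (@le_trans _ _ ((size K).+1%:R * (2 ^+ n.+1 * u))).
  apply: sum_mem_or_small.
  - by rewrite mulr_ge0// exprn_ge0.
  (* Used coordinate: the order gains nothing beyond the [b.+1] new factors, but such [k] are
     few. *)
  - move=> k kK; apply: U2 => // b.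
    have bn : (b <= n)%N by rewrite -ltnS.
    have HT : controlled K (s + b.+1) (o + b.+1) (transfer_constant * A) (n - b)
        (transfer z N Y k b.+1 X).
      apply: controlled_transfer_in => //; [lia|lia|].
      by apply: controlled_sub HX => //; lia.
    apply: (le_trans (IH _ _ q _ _ _ _ _ _ Kq HT)); [lia|lia|].
    rewrite -!addnA (_ : (b.+1 + (n - b) = n.+1)%N); last lia.
    apply: ler_pM; rewrite ?mulr_ge0 ?exprn_ge0 ?order_series_ge0//.
      by rewrite ler_wpM2l// mulr_ge0.
    by apply: ler_order_series; lia.
  (* Fresh coordinate: the order rises by one more, which absorbs the factor N through
     [ler_order_seriesS]. *)
  - move=> k kK; rewrite mulr_sumr.
    under eq_bigr do rewrite mulrnAr.
    apply: U2 => // b.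
    have bn : (b <= n)%N by rewrite -ltnS.
    have HT : controlled ((k : nat) :: K) (s + b.+1) (o + b.+1).+1
        (transfer_constant * A) (n - b) (transfer z N Y k b.+1 X).
      apply: controlled_transfer_out => //; [lia|lia|].
      by apply: controlled_sub HX => //; lia.
    apply: (@le_trans _ _ (N%:R * (transfer_constant * A *
        step_constant ^+ (n - b) *
        order_series (s + b.+1 + (n - b)) ((o + b.+1).+1 + (n - b)) (n - b)))).
      by rewrite ler_wpM2l//; apply: (IH _ _ q.+1 _ _ _ _ _ _ _ HT) => //; lia.
    rewrite mulrCA.
    rewrite (_ : ((o + b.+1).+1 + (n - b) = (o + n.+1).+1)%N); last lia.
    rewrite (_ : (s + b.+1 + (n - b) = s + n.+1)%N); last lia.
    apply: ler_pM; rewrite ?mulr_ge0 ?exprn_ge0 ?order_series_ge0//.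
      by rewrite ler_wpM2l// mulr_ge0.
    by apply: ler_order_seriesS; lia.
have Km : (size K < m.+1)%N by rewrite ltnS (leq_trans Kq)// (leq_trans _ nqm)// leq_addl.
apply: (@le_trans _ _ (m.+1%:R * (2 ^+ m * u))).
  have h1 : (size K).+1%:R <= m.+1%:R :> R by rewrite ler_nat.
  have h2 : 2 ^+ n.+1 <= 2 ^+ m :> R by rewrite ler_weXn2l// ler1n.
  have h3 : 2 ^+ n.+1 * u <= 2 ^+ m * u by exact: ler_wpM2r u0 _ _ h2.
  by apply: (ler_pM _ _ h1 h3); rewrite ?mulr_ge0 ?exprn_ge0.
by rewrite le_eqVlt /u exprS {2}/step_constant; apply/orP; left; apply/eqP; ring.
Qed.

(** The first step is done by hand, since [Y] has order 0 and only [D k Y] is controlled; from then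
    on [joint_cumulant_bound] applies with one used coordinate. *)
Lemma joint_cumulant_self_bound : (0 < m)%N ->
  `|joint_cumulant z N Y m Y| <=
  2 ^+ m * transfer_constant * step_constant ^+ m *
  (N%:R * order_series m.+1 m.+1 m.-1).
Proof.
move=> m0; set n := m.-1; have mE : m = n.+1 by rewrite prednK.
have W1 := step_constant_ge1.
have c1 := transfer_constant_ge1.
have c0 : 0 <= transfer_constant by rewrite (le_trans ler01).
pose v := transfer_constant * step_constant ^+ m * order_series m.+1 m.+1 n.
have v0 : 0 <= v.
  by rewrite !mulr_ge0 ?order_series_ge0// exprn_ge0// (le_trans ler01).
(* All [N] first coordinates get the same bound: this is the uncompensated factor N. *)
apply: (@le_trans _ _ (\sum_(k < N) 2 ^+ m * v)); last first.
  rewrite sumr_const card_ord -[leLHS]mulr_natl le_eqVlt /v.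
  by apply/orP; left; apply/eqP; ring.
rewrite {1}mE joint_cumulantS; apply: (le_trans (ler_norm_sum _ _ _)).
apply: ler_sum => k _; apply: (le_trans (ler_norm_sum _ _ _)).
apply: (@le_trans _ _ (\sum_(b < n.+1) v *+ 'C(n.+1, b.+1))); last first.
  rewrite sumrMnr -[leLHS]mulr_natl ler_wpM2r// -natrX ler_nat mE.
  exact: sum_bin_le.
apply: ler_sum => b _; rewrite normrMn lerMn2r; apply/orP; right.
have bn : (b <= n)%N by rewrite -ltnS.
have HM := controlled_tail k.+1 (controlled_glauber_self k (n - b)).
have HT : controlled [:: k : nat] (1 + b.+1) (1 + b.+1) transfer_constant (n - b)
    (transfer z N Y k b.+1 Y).
  have := controlled_transfer b.+1 (mem_head (k : nat) [::]) aY HM.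
  apply: controlled_sub => //.
  have bm : (b.+1 <= m)%N by rewrite mE.
  have rm : (n - b <= m)%N by rewrite mE leqW// leq_subr.
  have := ler_transfer_constant ler01 bm rm; rewrite !mulr1; apply: le_trans.
  by rewrite ler_peMr ?ler1n// mulr_ge0 ?exprn_ge0.
apply: (le_trans (joint_cumulant_bound (q := 1) _ _ HT)) => //.
  by rewrite addn1 mE ltnS leq_subr.
rewrite (_ : (1 + b.+1 + (n - b) = m.+1)%N); last by rewrite mE; lia.
have W0 : 0 <= step_constant by exact: le_trans W1.
have h1 : transfer_constant * step_constant ^+ (n - b) <=
    transfer_constant * step_constant ^+ m.
  by rewrite ler_wpM2l// ler_weXn2l// mE leqW// leq_subr.
have h2 := ler_order_series m.+1 m.+1 (leq_subr b n).
by apply: (ler_pM _ _ h1 h2); rewrite ?mulr_ge0 ?exprn_ge0 ?order_series_ge0.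
Qed.

End joint_cumulant_bound.

(** * Cumulants as derivatives of the log-moment generating function *)

Section cumulant_moments.
Context d (O : measurableType d) (R : realType) (P : probability O R).
Variable f : O -> R.
Hypothesis bf : bounded_measurable f.

Definition tilted_moment (j : nat) (t : R) : R :=
  \int[P]_w (f w ^+ j * expR (f w * t)).

Local Notation phi := tilted_moment.

Lemma bounded_measurable_tilted j t :
  bounded_measurable (fun w => f w ^+ j * expR (f w * t)).
Proof.
have [mf [M fM]] := bf.
apply: (@bounded_measurableM _ _ _ (fun w => f w ^+ j) (fun w => expR (f w * t))).
  by have := bounded_measurableX j bf; rewrite exprfctE.
split.
  apply: measurableT_comp; first exact: measurable_expR.
  by apply: measurable_funM => //; exact: measurable_cst.
exists (expR (M * `|t|)) => w.
rewrite ger0_norm ?expR_ge0// ler_expR (le_trans (ler_norm _))//.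
by rewrite normrM ler_wpM2r.
Qed.

Lemma is_derive_tilted_moment j (t : R) : is_derive t 1 (phi j) (phi j.+1 t).
Proof.
have [mf [M fM]] := bf.
have M0 : 0 <= M by apply: le_trans (fM point).
pose F (x : R) (w : O) := f w ^+ j * expR (f w * x).
have dF w (x : R) : is_derive x 1 (F ^~ w) (f w ^+ j.+1 * expR (f w * x)).
  rewrite /F exprS.
  have h1 : is_derive x 1 (fun x : R => f w * x) (f w).
    have := @is_deriveM _ _ (cst (f w)) id x 1 0 1 (is_derive_cst _ _ _) (is_derive_id _ _).
    by rewrite /= scaler0 addr0 [_ *: _]mulr1.
  have h2 := is_derive1_comp (is_derive_expR (f w * x)) h1.
  have := @is_deriveM _ _ (cst (f w ^+ j)) _ x 1 0 _ (is_derive_cst _ _ _) h2.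
  rewrite /= scaler0 addr0 => h3.
  apply: (is_derive_eq h3); rewrite /GRing.scale/=; ring.
have Ia : `](t - 1), (t + 1)[%classic t.
  by rewrite /= in_itv/= ltrBlDr ltrDl ltr01.
have iF x : `](t - 1), (t + 1)[%classic x -> P.-integrable setT (EFin \o F x).
  by move=> _; apply: bounded_measurable_integrable; exact: bounded_measurable_tilted.
have dF1 x w : `](t - 1), (t + 1)[%classic x -> setT w -> derivable (F ^~ w) x 1.
  by move=> _ _; have [] := dF w x.
(* A constant dominates the derivative, as |x| <= |t| + 1 on the interval of radius 1 around t. *)
pose G (w : O) := M ^+ j.+1 * expR (M * (`|t| + 1)).
have G0 w : 0 <= G w by rewrite mulr_ge0 ?exprn_ge0 ?expR_ge0.
have iG : P.-integrable setT (EFin \o G).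
  by apply: bounded_measurable_integrable; exact: bounded_measurable_cst.
have pF x w : partial1of2 F x w = f w ^+ j.+1 * expR (f w * x).
  by rewrite partial1of2E; have [_ ->] := dF w x.
have GF x w : `](t - 1), (t + 1)[%classic x -> setT w -> `|partial1of2 F x w| <= G w.
  move=> /= xt _; rewrite pF normrM normrX /G ler_pM ?exprn_ge0//.
    by rewrite lerXn2r ?nnegrE.
  rewrite ger0_norm ?expR_ge0// ler_expR (le_trans (ler_norm _))// normrM ler_pM//.
  move: xt; rewrite in_itv/= => /andP[x1 x2].
  have := ler_norm t; have := ler_norm (- t); rewrite normrN => h1 h2.
  by rewrite ler_norml; apply/andP; split; lra.
apply: DeriveDef.
  exact: (derivable_under_integral measurableT Ia iF dF1 G0 iG GF).
rewrite -derive1E.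
rewrite (differentiation_under_integral measurableT Ia iF dF1 G0 iG GF).
by apply: eq_Rintegral => w _; rewrite pF.
Qed.

Lemma tilted_moment0_gt0 t : 0 < phi 0 t.
Proof.
have [mf [M fM]] := bf.
apply: (@lt_le_trans _ _ (expR (- (M * `|t|)))); first exact: expR_gt0.
rewrite -[leLHS](Rintegral_prob_cst P); apply: ler_Rintegral.
- exact: bounded_measurable_cst.
- exact: bounded_measurable_tilted.
move=> w; rewrite expr0 mul1r ler_expR lerNl (le_trans (ler_norm _))//.
by rewrite normrN normrM ler_wpM2r.
Qed.

Lemma tilted_moment_at0 j : phi j 0 = \int[P]_w (f w ^+ j).
Proof.
by apply: eq_Rintegral => w _; rewrite mulr0 expR0 mulr1.
Qed.

Definition log_mgf_derivative n : R -> R :=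
  derive1n n (fun t => phi 1 t / phi 0 t).

Arguments log_mgf_derivative : simpl never.

(** This is the n-th derivative of (log phi_0)' phi_0 = phi_1. Differentiability and the identity
    are proved together, as each step of one relies on the other. *)
Lemma log_mgf_derivative_recursion n :
  (forall i (t : R), (i < n)%N -> derivable (log_mgf_derivative i) t 1) /\
  forall t, \sum_(i < n.+1) log_mgf_derivative i t * phi (n - i) t *+ 'C(n, i) =
    phi n.+1 t.
Proof.
elim: n => [|n [IHd IH]].
  split=> // t; rewrite big_ord1 /log_mgf_derivative/= mulfVK//.
  by rewrite gt_eqF// tilted_moment0_gt0.
have du i (t : R) : (i < n)%N ->
    is_derive t 1 (log_mgf_derivative i) (log_mgf_derivative i.+1 t).
  move=> ni; apply: DeriveDef; first exact: IHd.
  by rewrite /log_mgf_derivative derive1nS derive1E.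
(* Solved for its last term, the identity expresses the n-th derivative through lower ones and
   tilted moments, so it is differentiable. *)
have uE : log_mgf_derivative n = (fun t => (phi n.+1 t -
    \sum_(i < n) log_mgf_derivative i t * phi (n - i) t *+ 'C(n, i)) * (phi 0 t)^-1).
  apply/funext => t; rewrite -IH big_ord_recr/= subnn binn mulr1n addrAC subrr add0r.
  by rewrite mulfK// gt_eqF// tilted_moment0_gt0.
have dterm i (t : R) : (i < n)%N -> is_derive t 1
    (fun t => log_mgf_derivative i t * phi (n - i) t *+ 'C(n, i))
    ((log_mgf_derivative i.+1 t * phi (n - i) t +
      log_mgf_derivative i t * phi (n - i).+1 t) *+ 'C(n, i)).
  move=> ni.
  have h := is_deriveM (du i t ni) (is_derive_tilted_moment (n - i) t).
  rewrite (_ : (fun t => _) = ('C(n, i)%:R : R) \*: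
      (log_mgf_derivative i * phi (n - i) : R -> R)); last first.
    by apply/funext => t' /=; rewrite -mulr_natl.
  apply: is_derive_eq (is_deriveZ _ h) _.
  by rewrite -[RHS]mulr_natl /GRing.scale/=; ring.
have dun t : derivable (log_mgf_derivative n) t 1.
  rewrite uE.
  have hs := @is_derive_sum _ _ _ n (fun i t => log_mgf_derivative i t *
    phi (n - i) t *+ 'C(n, i)) t 1 _ (fun i => dterm i t (ltn_ord i)).
  rewrite fct_sumE in hs.
  have h0 : phi 0 t != 0 by rewrite gt_eqF// tilted_moment0_gt0.
  have := is_deriveM (is_deriveB (is_derive_tilted_moment n.+1 t) hs)
    (is_deriveV h0 (is_derive_tilted_moment 0 t)).
  by case.
split=> [i t|t].
  by rewrite ltnS leq_eqVlt => /predU1P[->//|]; exact: IHd.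
have {}du i (t' : R) : (i < n.+1)%N ->
    is_derive t' 1 (log_mgf_derivative i) (log_mgf_derivative i.+1 t').
  rewrite ltnS leq_eqVlt => /predU1P[->|]; last exact: du.
  by apply: DeriveDef => //; rewrite /log_mgf_derivative derive1nS derive1E.
have {}dterm (i : 'I_n.+1) : is_derive t 1
    (fun t => log_mgf_derivative i t * phi (n - i) t *+ 'C(n, i))
    ((log_mgf_derivative i.+1 t * phi (n - i) t +
      log_mgf_derivative i t * phi (n - i).+1 t) *+ 'C(n, i)).
  have h := is_deriveM (du i t (ltn_ord i)) (is_derive_tilted_moment (n - i) t).
  rewrite (_ : (fun t => _) = ('C(n, i)%:R : R) \*:
      (log_mgf_derivative i * phi (n - i) : R -> R)); last first.
    by apply/funext => t' /=; rewrite -mulr_natl.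
  apply: is_derive_eq (is_deriveZ _ h) _.
  by rewrite -[RHS]mulr_natl /GRing.scale/=; ring.
have := @is_derive_sum _ _ _ n.+1 (fun i t => log_mgf_derivative i t *
    phi (n - i) t *+ 'C(n, i)) t 1 _ dterm.
rewrite fct_sumE (_ : (fun t => _) = phi n.+1); last by apply/funext => t'; exact: IH.
have [_ <-] := is_derive_tilted_moment n.+1 t.
move=> [_ ->].
(* Pascal's rule recombines the two halves of the product rule. *)
pose F i := log_mgf_derivative i t * phi (n.+1 - i) t.
rewrite big_ord_recl/= bin0 mulr1n -[log_mgf_derivative 0 t * _]/(F 0%N).
under eq_bigr => i _ do rewrite /bump/= add1n binS mulrnDr subSS.
under [RHS]eq_bigr => i _ do rewrite mulrnDl.
rewrite !big_split/= addrA [RHS]addrC; congr (_ + _).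
transitivity (\sum_(i < n.+2) F i *+ 'C(n, i)).
  by rewrite [RHS]big_ord_recl/= bin0 mulr1n; congr (_ + _).
rewrite big_ord_recr/= bin_small// mulr0n addr0; apply: eq_bigr => i _.
by rewrite /F subSn// -ltnS.
Qed.

Lemma cumulant_recursion n :
  \sum_(i < n.+1) cumulant P i.+1 f * (\int[P]_w (f w ^+ (n - i))) *+ 'C(n, i) =
  \int[P]_w (f w ^+ n.+1).
Proof.
have [_ /(_ 0)] := log_mgf_derivative_recursion n.
rewrite tilted_moment_at0 => <-; apply: eq_bigr => i _.
rewrite tilted_moment_at0; congr (_ * _ *+ _).
rewrite /cumulant /log_mgf_derivative derive1Sn; congr (derive1n _ _ _).
have -> : (fun t => @ln R (fine ('M_P f t)%E)) = @ln R \o phi 0.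
  apply/funext => t /=; congr (ln _); rewrite /mmt_gen_fun unlock /=.
  by congr fine; apply: eq_integral => w _ /=; rewrite expr0 mul1r.
apply/funext => t; rewrite derive1E.
have h := is_derive1_comp (is_derive1_ln (tilted_moment0_gt0 t))
  (is_derive_tilted_moment 0 t).
by have [_ ->] := h; rewrite mulrC.
Qed.

End cumulant_moments.

(** * Identification of the cumulants and of the sums in the theorem *)

Section conclusion.
Context (R : realType) (dO : measure_display) (Omega : measurableType dO).
Context (P : probability Omega R).
Context (dT : measure_display) (T : measurableType dT).
Context (z : nat -> {RV P >-> T}) (N : nat).

Lemma admissible_of_first (f : N.-tuple T -> R) :
  measurable_fun [set: N.-tuple T] f -> (exists M : R, forall x, `|f x| <= M) ->
  admissible N (of_first f).
Proof.
move=> mf [M fM]; split.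
- by exists M => x; exact: fM.
- move=> x y xy; congr f; apply: eq_from_tnth => i.
  by rewrite !tnth_mktuple xy.
- move=> d S g mg; apply: measurableT_comp => //.
  apply/measurable_fun_tnthP => i.
  by rewrite (_ : _ \o _ = g i)//; apply/funext => s /=; rewrite tnth_mktuple.
Qed.

Hypothesis z_indep : mutually_independent z.
Variable Y : functional R T.
Hypothesis aY : admissible N Y.

Lemma meanX n : mean z (Y ^+ n) = \int[P]_w (eval_data z Y w ^+ n).
Proof. by apply: eq_Rintegral => w _; rewrite /eval_data exprfctE. Qed.

(** Both sequences satisfy the same moment recursion, in which the term of highest index has
    coefficient E[1] = 1; strong induction cancels the lower terms. *)
Lemma cumulant_joint_cumulant n :
  cumulant P n.+1 (eval_data z Y) = joint_cumulant z N Y n Y.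
Proof.
have [m nm] := ubnP n; elim: m n nm => // m IH n; rewrite ltnS => nm.
have := cumulant_recursion P (admissible_eval z aY) n.
rewrite -meanX exprS (moment_joint_cumulant z_indep aY n aY).
rewrite !big_ord_recr/= subnn !binn -meanX !expr0 !(mean_cst z 1) !mulr1 !mulr1n.
rewrite [in X in X = _](eq_bigr (fun i : 'I_n =>
  joint_cumulant z N Y i Y * mean z (Y ^+ (n - i)) *+ 'C(n, i))); last first.
  by move=> i _; rewrite IH ?meanX// (leq_trans _ nm).
by move/addrI.
Qed.

Lemma order_sumE s Q o : order_sum z Y s Q o =
  \sum_(a : {ffun 'I_s -> 'I_Q.+1} |
      [forall j, (1 <= a j)%N] && (\sum_j (a j : nat) == o)%N)
    \prod_(j < s) order_glauber_norm z Q Y (a j).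
Proof.
pose b i := if (0 < i)%N then order_glauber_norm z Q Y i else 0.
rewrite /order_sum /order_poly.
rewrite poly_def -/b -[s in LHS]card_ord -prodr_const bigA_distr_bigA/= coef_sum.
rewrite [RHS]big_mkcond/=; apply: eq_bigr => a _.
rewrite scaler_prod prodrXr coefZ coefXn eq_sym.
(* A family with some [a j = 0] picks the zero constant coefficient, so its product vanishes. *)
case: (altP forallP) => [a1|/forallPn[j aj]] /=; last first.
  by rewrite (bigD1 j)//= /b (negbTE aj) !mul0r.
case: eqP => _; last by rewrite mulr0.
by rewrite mulr1; apply: eq_bigr => j _; rewrite /b a1.
Qed.

End conclusion.

Theorem theorem2p2 (R : realType) (d m : nat) (hm : (1 <= m)%N) :
  exists C : R, 0 < C /\
  forall (dO : measure_display) (Omega : measurableType dO)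
    (P : probability Omega R)
    (z : nat -> {RV P >-> phase_space R d})
    (z_indep : mutually_independent z)
    (z_id : identically_distributed z)
    (z_gen : generate_sigma_algebra z)
    (N : nat) (hN : (1 <= N)%N)
    (f : N.-tuple (phase_space R d) -> R)
    (f_meas : measurable_fun [set: N.-tuple (phase_space R d)] f)
    (f_bnd : exists M : R, forall x, `|f x| <= M),
  let Y := of_first f in
  (`| cumulant P m.+1 (eval_data z Y) |%:E <=
   C%:E * \sum_(k < m) (N%:R ^+ k.+1)%:E *
     \sum_(a : {ffun 'I_m.+1 -> 'I_(m + k + 2)} |
            [forall j, (1 <= a j)%N] && (\sum_j (a j : nat) == m + k + 1)%N)
       \prod_(j < m.+1)
         glauber_norm z (a j) ((m + k + 1)%:R / (a j)%:R) Y)%E.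
Proof.
have t0 := lt_le_trans ltr01 (transfer_constant_ge1 R m).
have s0 := lt_le_trans ltr01 (step_constant_ge1 R m).
have C0 : 0 < 2 ^+ m * transfer_constant R m * step_constant R m ^+ m.
  by rewrite !mulr_gt0 ?exprn_gt0.
exists (2 ^+ m * transfer_constant R m * step_constant R m ^+ m); split=> //.
move=> dO Omega P z z_indep _ _ N _ f f_meas f_bnd.
set Y := of_first f; cbv zeta.
have aY : admissible N Y by exact: admissible_of_first.
rewrite (cumulant_joint_cumulant z_indep aY).
have := joint_cumulant_self_bound z_indep aY hm.
rewrite -lee_fin => /le_trans; apply.
rewrite EFinM lee_pmul2l ?lte_fin//.
(* What remains is an equality term by term: v = k gives the total order Q = m + 1 + k, and the
   extra N turns [N ^+ k] into [N ^+ k.+1]. *)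
rewrite /order_series prednK// mulr_sumr -sumEFin le_eqVlt.
apply/orP; left; apply/eqP; apply: eq_bigr => k _.
rewrite mulrA -exprS EFinM; congr (_ * _)%E.
rewrite order_sumE -sumEFin.
rewrite (_ : (m.+1 + k = m + k + 1)%N); last by rewrite addSn addn1.
rewrite (_ : (m + k + 2 = (m + k + 1).+1)%N); last by rewrite addn2 addn1.
apply: eq_bigr => a /andP[/forallP a1 _].
rewrite -prodEFin; apply: eq_bigr => j _.
by rewrite (glauber_norm_fin_num z_indep aY)// a1 -ltnS ltn_ord.
Qed.
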